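(* Let $S\subset\mathbf{R}^2$ be a planar Gutkin billiard table. Consider the billiard ball map $T$ inside $S$ on the phase cylinder, with coordinates $(x,\alpha)$, $x\in S$, $\alpha\in(0,\pi)$ the angle between the outgoing ray and the tangent line at $x$. Let $0\le\delta_1<\delta_2\le\pi/2$ be two neighboring values such that the constant-angle curves $\{\alpha=\delta_1\}$ and $\{\alpha=\delta_2\}$ are $T$-invariant (where $\{\alpha=0\}$ denotes the boundary of the cylinder), and let $\Omega_{\delta_1\delta_2}=\{\delta_1\le\alpha\le\delta_2\}$ be the strip between them. If $\Omega_{\delta_1\delta_2}$ is foliated by rotational $T$-invariant curves (continuous invariant curves which are graphs over $S$, i.e. homotopic to the base circle of the cylinder), then $S$ is a circle.
   Context: A Gutkin billiard table in $\mathbf{R}^2$ is a smooth closed curve $S$ bounding a compact convex domain, with strictly positive curvature, for which there exists $\delta\in(0,\pi/2)$ such that for every pair of distinct points $p,q\in S$: if the angle between the vector $\overrightarrow{pq}$ and the tangent line $T_pS$ equals $\delta$, then the angle between $\overrightarrow{pq}$ and the tangent line $T_qS$ also equals $\delta$. The billiard ball map sends a chord leaving $x$ at angle $\alpha$ and hitting $S$ at $y$ to the chord leaving $y$ obtained by the law of reflection. *)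

(* Defs.v *)
From Stdlib Require Import Reals Lra.
Open Scope R_scope.

Definition smooth (f : R -> R) : Prop :=
  exists D : nat -> R -> R,
    (forall x, D 0%nat x = f x) /\
    (forall (n : nat) (x : R), derivable_pt_lim (D n) x (D (S n) x)).

Definition line_angle (vx vy tx ty : R) : R :=
  acos (Rabs (vx * tx + vy * ty) / (sqrt (vx ^ 2 + vy ^ 2) * sqrt (tx ^ 2 + ty ^ 2))).

(* The curve S is parametrized by t |-> (X t, Y t), with velocity (dX t, dY t).
   Unit tangent: (dX,dY)/|.|;  unit normal (rotated by +pi/2): (-dY,dX)/|.|,
   which points inside when the parametrization is counterclockwise. *)
Definition speed (dX dY : R -> R) (t : R) : R := sqrt (dX t ^ 2 + dY t ^ 2).

(* Billiard ball map on the phase cylinder, as a relation: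
   billiard_step X Y dX dY t a s b  means  T (t, a) = (s, b):
   the ray leaving gamma(t) at angle a (measured from the tangent, in (0,pi))
   hits S at gamma(s), and the reflected ray leaves gamma(s) at angle b. *)
Definition billiard_step (X Y dX dY : R -> R) (t a s b : R) : Prop :=
  0 < a < PI /\ 0 < b < PI /\
  (X s <> X t \/ Y s <> Y t) /\
  (exists lam : R, 0 < lam /\
     X s - X t = lam * (cos a * dX t - sin a * dY t) / speed dX dY t /\
     Y s - Y t = lam * (cos a * dY t + sin a * dX t) / speed dX dY t) /\
  cos b = ((X s - X t) * dX s + (Y s - Y t) * dY s)
          / (sqrt ((X s - X t) ^ 2 + (Y s - Y t) ^ 2) * speed dX dY s).

Definition const_angle_invariant (X Y dX dY : R -> R) (d : R) : Prop :=
  forall t s b, billiard_step X Y dX dY t d s b -> b = d.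

Definition graph_invariant (X Y dX dY : R -> R) (g : R -> R) : Prop :=
  forall t s b, billiard_step X Y dX dY t (g t) s b -> b = g s.

Definition gutkin_table (X Y dX dY ddX ddY : R -> R) (L : R) : Prop :=
  smooth X /\ smooth Y /\
  (forall t, derivable_pt_lim X t (dX t)) /\
  (forall t, derivable_pt_lim Y t (dY t)) /\
  (forall t, derivable_pt_lim dX t (ddX t)) /\
  (forall t, derivable_pt_lim dY t (ddY t)) /\
  0 < L /\
  (forall t, X (t + L) = X t /\ Y (t + L) = Y t) /\
  (forall t s, 0 <= t < L -> 0 <= s < L -> X t = X s -> Y t = Y s -> t = s) /\
  (forall t, 0 < dX t ^ 2 + dY t ^ 2) /\
  (forall t, 0 < dX t * ddY t - dY t * ddX t) /\
  (exists delta : R, 0 < delta < PI / 2 /\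
     forall p q : R, (X p <> X q \/ Y p <> Y q) ->
       line_angle (X q - X p) (Y q - Y p) (dX p) (dY p) = delta ->
       line_angle (X q - X p) (Y q - Y p) (dX q) (dY q) = delta).

Definition strip_foliated (X Y dX dY : R -> R) (L d1 d2 : R) : Prop :=
  exists F : (R -> R) -> Prop,
    (forall g, F g ->
       continuity g /\ (forall t, g (t + L) = g t) /\
       (forall t, d1 <= g t <= d2) /\ graph_invariant X Y dX dY g) /\
    (forall g1 g2, F g1 -> F g2 -> (exists t, g1 t = g2 t) -> forall t, g1 t = g2 t) /\
    (forall t a, d1 <= a <= d2 -> exists g, F g /\ g t = a).

(* Main.v *)
(** Parametrize the table by the angle [s] of its tangent, with radius of curvature [rad s] and
    support function [supp s].

    The chords issued from an invariant graph [g] are calibrated: the maximum over [s] of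
    [|p y - p s| - int_s^y rad cos g] is attained exactly at the billiard preimage of [y] and does
    not depend on [y].  Turning both ends of every chord of an orbit by the same angle [e] therefore
    does not increase the length beyond a coboundary; since [|v| >= v . (cos phi, sin phi)], this
    says that the Birkhoff sums of [2 sin a (supp (s + e) - supp s)] are bounded above.  Averaging
    over [e], so are those of [2 sin a (P - 2 PI supp s)], where [P] is the perimeter.

    The strip between two constant-angle invariant curves carries the invariant measure
    [rad s sin a ds da], so this function has nonpositive integral: [P^2 <= 2 PI int supp rad], the
    reversed isoperimetric inequality.  Hurwitz' proof of the isoperimetric inequality then gives
    that [rad] is constant.

    Convexity of the table is not part of the data: a locally convex curve of turning number at
    least two has two points with the same oriented tangent line, in the order that forces the
    full turn between them to cross itself. *)

Require Import Defs.
From Stdlib Require Import Reals ZArith Lra Lia ClassicalEpsilon.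
From Coquelicot Require Import Coquelicot.
Open Scope R_scope.

(** * Real analysis *)

(** A leaf is only a continuous graph, so nothing along it can be differentiated. The calibration
    copes with this: the maximum over [s] is touched from below at each [y] by a differentiable
    function with zero derivative there, and this already makes a continuous function constant. The
    bounded potential of a leaf may vary wildly from leaf to leaf, so its coboundary cannot be
    integrated over the strip. What is integrated instead are the Birkhoff sums of the explicit
    continuous function [2 sin a (P - 2 PI supp s)]. A bound that is uniform in the leaf and in the
    number of steps then forces a nonpositive integral. Against [rad s sin a ds da] this function
    separates: integrating out [s] leaves [2 sin^2 a (P^2 - 2 PI int supp rad)], so the strip
    contributes only a positive factor, however thin it is. As [int supp rad] is twice the area,
    this is the isoperimetric inequality with the wrong sign. *)

Lemma continuous_of_continuity (f : R -> R) x : continuity_pt f x -> continuous f x.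
Proof. apply continuity_pt_filterlim. Qed.

Lemma is_derive_continuity (f : R -> R) x l : is_derive f x l -> continuity_pt f x.
Proof.
  intros H. apply continuity_pt_filterlim.
  apply (ex_derive_continuous f). now exists l.
Qed.

Lemma is_derive_val (f : R -> R) (x l l' : R) : is_derive f x l -> l = l' -> is_derive f x l'.
Proof. now intros H <-. Qed.

Lemma is_derive_compose (f g : R -> R) (x df dg : R) :
  is_derive f (g x) df -> is_derive g x dg -> is_derive (fun t => f (g t)) x (dg * df).
Proof. apply (is_derive_comp f g). Qed.

Lemma ex_RInt_continuity (f : R -> R) a b : continuity f -> ex_RInt f a b.
Proof.
  intros H. apply (ex_RInt_continuous f). intros z _.
  apply continuous_of_continuity, H.
Qed.

Lemma is_derive_RInt_continuity (f : R -> R) a x :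
  continuity f -> is_derive (fun t => RInt f a t) x (f x).
Proof.
  intros H. apply is_derive_RInt with a.
  - apply filter_forall. intros y. apply RInt_correct. now apply ex_RInt_continuity.
  - apply continuous_of_continuity, H.
Qed.

Lemma RInt_add_continuity (f : R -> R) a b c :
  continuity f -> RInt f a b + RInt f b c = RInt f a c.
Proof.
  intros C. apply (RInt_Chasles f a b c); now apply ex_RInt_continuity.
Qed.

Lemma RInt_ext_all (f g : R -> R) a b : (forall x : R, f x = g x) -> RInt f a b = RInt g a b.
Proof. intros H. apply RInt_ext. intros; apply H. Qed.

Lemma RInt_of_derive (f df : R -> R) a b :
  (forall x : R, is_derive f x (df x)) -> continuity df -> RInt df a b = f b - f a.
Proof.
  intros H C. apply is_RInt_unique. apply (is_RInt_derive f df).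
  - intros; apply H.
  - intros; apply continuous_of_continuity, C.
Qed.

Lemma eq_of_derive_eq (f g : R -> R) (df : R -> R) a :
  (forall x : R, is_derive f x (df x)) -> (forall x : R, is_derive g x (df x)) ->
  f a = g a -> forall x, f x = g x.
Proof.
  intros Hf Hg E x.
  destruct (MVT_gen (fun t => f t - g t) a x (fun _ => 0)) as [c [_ Hc]].
  - intros t _. apply is_derive_val with (df t - df t); [|ring]. apply (is_derive_minus f g); auto.
  - intros t _. eapply is_derive_continuity. apply (is_derive_minus f g); auto.
  - cbv beta in Hc. lra.
Qed.

Lemma RInt_periodic (f : R -> R) T a :
  continuity f -> (forall x, f (x + T) = f x) -> RInt f a (a + T) = RInt f 0 T.
Proof.
  intros C P.
  replace (RInt f 0 T) with ((fun a => RInt f 0 (a + T) - RInt f 0 a) 0).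
  2:{ cbv beta. rewrite RInt_point, Rplus_0_l. apply Rminus_0_r. }
  transitivity ((fun a => RInt f 0 (a + T) - RInt f 0 a) a).
  { cbv beta. pose proof (RInt_add_continuity f 0 a (a + T) C). lra. }
  apply eq_of_derive_eq with (f := fun a => RInt f 0 (a + T) - RInt f 0 a)
    (g := fun _ => RInt f 0 (0 + T) - RInt f 0 0) (df := fun _ => 0) (a := 0); auto.
  - intros x. apply is_derive_val with (1 * f (x + T) - f x); [|rewrite P; ring].
    apply (is_derive_minus (fun a => RInt f 0 (a + T)) (fun a => RInt f 0 a)).
    + apply (is_derive_comp (fun t => RInt f 0 t) (fun t => t + T)).
      * now apply is_derive_RInt_continuity.
      * auto_derive; auto; ring.
    + now apply is_derive_RInt_continuity.
  - intros x. apply (is_derive_const (V := R_NormedModule)).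
Qed.

Lemma RInt_shift_periodic (f : R -> R) T s :
  continuity f -> (forall x, f (x + T) = f x) -> RInt (fun x => f (x + s)) 0 T = RInt f 0 T.
Proof.
  intros C P. rewrite <- (RInt_periodic f T s C P).
  transitivity (RInt (fun x => scal 1 (f (1 * x + s))) 0 T).
  { apply RInt_ext. intros x _. rewrite Rmult_1_l. unfold scal; simpl; unfold mult; simpl.
    now rewrite Rmult_1_l. }
  replace (RInt f s (s + T)) with (RInt f (1 * 0 + s) (1 * T + s)) by (f_equal; ring).
  apply (RInt_comp_lin f 1 s 0 T). now apply ex_RInt_continuity.
Qed.

Lemma periodic_nat (f : R -> R) T : (forall x, f (x + T) = f x) ->
  forall (n : nat) x, f (x + INR n * T) = f x.
Proof.
  intros P n; induction n as [|n IH]; intros x.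
  - simpl. f_equal; ring.
  - rewrite S_INR. replace (x + (INR n + 1) * T) with ((x + INR n * T) + T) by ring.
    now rewrite P.
Qed.

Lemma periodic_Z (f : R -> R) T : (forall x, f (x + T) = f x) ->
  forall (n : Z) x, f (x + IZR n * T) = f x.
Proof.
  intros P n x. destruct (Z_le_gt_dec 0 n) as [H|H].
  - rewrite <- (Z2Nat.id n) by lia. rewrite <- INR_IZR_INZ. now apply periodic_nat.
  - rewrite <- (periodic_nat f T P (Z.to_nat (- n)) (x + IZR n * T)).
    rewrite INR_IZR_INZ, Z2Nat.id by lia. rewrite opp_IZR. f_equal; ring.
Qed.

Lemma reduce_mod (T : R) : 0 < T -> forall x, exists n : Z, 0 <= x + IZR n * T < T.
Proof.
  intros HT x. exists (- Int_part (x / T))%Z.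
  destruct (base_Int_part (x / T)) as [H1 H2].
  rewrite opp_IZR. set (k := IZR (Int_part (x / T))) in *.
  assert (E : x = x / T * T) by (field; lra).
  split.
  - assert (k * T <= x / T * T) by (apply Rmult_le_compat_r; lra). lra.
  - assert (x / T * T < (k + 1) * T) by (apply Rmult_lt_compat_r; lra). lra.
Qed.

Lemma periodic_bounded (f : R -> R) T : 0 < T -> continuity f ->
  (forall x, f (x + T) = f x) -> exists M, 0 < M /\ forall x, Rabs (f x) <= M.
Proof.
  intros HT C P.
  destruct (continuity_ab_maj (fun x => Rabs (f x)) 0 T) as [m [Hm _]].
  - lra.
  - intros c _. apply (continuity_pt_comp f Rabs); [apply C | apply Rcontinuity_abs].
  - exists (Rabs (f m) + 1). split. { pose proof (Rabs_pos (f m)); lra. }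
    intros x. destruct (reduce_mod T HT x) as [n Hn].
    rewrite <- (periodic_Z f T P n x). specialize (Hm (x + IZR n * T)). simpl in Hm. lra.
Qed.

Lemma strictly_increasing_of_derive (f df : R -> R) a b :
  a < b -> (forall x : R, is_derive f x (df x)) -> (forall x, a < x < b -> 0 < df x) -> f a < f b.
Proof.
  intros ab H P. 
  destruct (MVT_cor2 f df a b ab) as [c [E Hc]].
  - intros c _. apply is_derive_Reals, H.
  - assert (0 < df c * (b - a)) by (apply Rmult_lt_0_compat; [auto|lra]). lra.
Qed.

(** * Continuity in two variables and iterated integrals *)

Lemma continuity_2d_pt_comp (f g k : R -> R -> R) x y :
  continuity_2d_pt f (g x y) (k x y) -> continuity_2d_pt g x y -> continuity_2d_pt k x y ->
  continuity_2d_pt (fun u v => f (g u v) (k u v)) x y.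
Proof.
  intros Hf Hg Hk eps. destruct (Hf eps) as [d Hd].
  generalize (locally_2d_and _ _ _ _ (Hg d) (Hk d)). apply locally_2d_impl, locally_2d_forall.
  intros u v [A B]. now apply Hd.
Qed.

Lemma continuity_2d_pt_slice1 (f : R -> R -> R) x y :
  continuity_2d_pt f x y -> continuity_pt (fun u => f u y) x.
Proof.
  intros H. apply continuity_pt_filterlim, filterlim_locally. intros eps.
  destruct (H eps) as [d Hd]. exists d. intros u Hu. apply Hd; [exact Hu|].
  rewrite Rminus_diag, Rabs_R0. apply cond_pos.
Qed.

Lemma continuity_2d_pt_slice2 (f : R -> R -> R) x y :
  continuity_2d_pt f x y -> continuity_pt (fun v => f x v) y.
Proof.
  intros H. apply continuity_pt_filterlim, filterlim_locally. intros eps.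
  destruct (H eps) as [d Hd]. exists d. intros u Hu. apply Hd; [|exact Hu].
  rewrite Rminus_diag, Rabs_R0. apply cond_pos.
Qed.

Lemma continuity_RInt_param (f : R -> R -> R) c d :
  (forall x y, continuity_2d_pt f x y) -> continuity (fun x => RInt (f x) c d).
Proof.
  intros C.
  assert (EX : forall x, ex_RInt (f x) c d).
  { intros x. apply ex_RInt_continuity. intros y. apply continuity_2d_pt_slice2, C. }
  enough (W : forall c d, c <= d -> (forall x, ex_RInt (f x) c d) -> continuity (fun x => RInt (f x) c d)).
  { destruct (Rle_dec c d) as [H|H]; [now apply W|].
    assert (E : forall x, - RInt (f x) d c = RInt (f x) c d).
    { intros x. apply (opp_RInt_swap (f x)). apply ex_RInt_swap, EX. }
    intros x. apply continuity_pt_ext with (fun x => - RInt (f x) d c); [exact E|].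
    apply continuity_pt_opp. apply W; [lra|]. intros; apply ex_RInt_swap, EX. }
  clear c d EX. intros c d H EX x.
  apply continuity_pt_filterlim, filterlim_locally. intros eps.
  (* The [+ 1] keeps the denominator positive when [c = d]. *)
  assert (He : 0 < eps / (d - c + 1)) by (apply Rdiv_lt_0_compat; [apply cond_pos|lra]).
  destruct (uniform_continuity_2d_1d' f c d x (fun y _ => C x y) (mkposreal _ He)) as [del Hd].
  exists del. intros u Hu. change (Rabs (u - x) < del) in Hu.
  change (Rabs (RInt (f u) c d - RInt (f x) c d) < eps).
  assert (E : RInt (f u) c d - RInt (f x) c d = RInt (fun t => f u t - f x t) c d).
  { symmetry. apply (RInt_minus (f u) (f x)); auto. }
  rewrite E.
  apply Rle_lt_trans with ((d - c) * (eps / (d - c + 1))).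
  - apply (abs_RInt_le_const (fun t => f u t - f x t)); auto.
    + apply (ex_RInt_minus (f u) (f x)); auto.
    + intros t Ht. apply Rlt_le. apply (Hd t x t u); auto; pose proof (cond_pos del).
      * lra.
      * apply Rabs_lt_between in Hu. lra.
      * rewrite Rminus_diag, Rabs_R0; auto.
  - apply Rlt_le_trans with ((d - c + 1) * (eps / (d - c + 1))).
    + apply Rmult_lt_compat_r; lra.
    + right. field. lra.
Qed.

(** As functions of [b], both sides vanish at [b = a] and have derivative [RInt (f b) c d]; on the
    right this is differentiation under the integral sign. *)
Lemma RInt_fubini (f : R -> R -> R) a b c d :
  (forall x y, continuity_2d_pt f x y) ->
  RInt (fun x => RInt (fun y => f x y) c d) a b = RInt (fun y => RInt (fun x => f x y) a b) c d.
Proof.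
  intros C.
  assert (S1 : forall y, continuity (fun x => f x y)) by (intros y x; apply continuity_2d_pt_slice1, C).
  assert (S2 : forall x, continuity (f x)) by (intros x y; apply continuity_2d_pt_slice2, C).
  apply eq_of_derive_eq with (f := fun b => RInt (fun x => RInt (f x) c d) a b)
    (g := fun b => RInt (fun y => RInt (fun x => f x y) a b) c d)
    (df := fun x => RInt (f x) c d) (a := a).
  - intros x. apply (is_derive_RInt_continuity (fun x => RInt (f x) c d)).
    now apply continuity_RInt_param.
  - intros x.
    assert (DE : forall y u, Derive (fun z => RInt (fun x0 => f x0 y) a z) u = f u y).
    { intros y u. apply is_derive_unique. apply (is_derive_RInt_continuity (fun x0 => f x0 y)), S1. }
    replace (RInt (f x) c d) with
      (RInt (fun t => Derive (fun u => RInt (fun x0 => f x0 t) a u) x) c d).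
    2:{ apply RInt_ext. intros y _. apply DE. }
    apply (is_derive_RInt_param (fun u y => RInt (fun x0 => f x0 y) a u)).
    + apply filter_forall. intros u t _. eexists.
      apply (is_derive_RInt_continuity (fun x0 => f x0 t)), S1.
    + intros t _. apply continuity_2d_pt_ext with f; auto.
    + apply filter_forall. intros u. apply ex_RInt_continuity.
      apply (continuity_RInt_param (fun y x => f x y)).
      intros p q eps. destruct (C q p eps) as [dl H]. exists dl. intros; now apply H.
  - rewrite RInt_point. symmetry. 
    transitivity (RInt (fun _ : R => 0) c d).
    + apply RInt_ext. intros x _. apply (RInt_point a (fun x0 => f x0 x)).
    + rewrite RInt_const. apply Rmult_0_r.
Qed.

(** For every [eps], touching from below gives locally [m x >= m y - eps |x - y|]. A continuity
    argument makes this bound global in both directions, and [eps] tends to 0. The lemma serves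
    maxima whose maximizers depend on the parameter in an uncontrolled way. *)
Lemma constant_of_zero_subderivative (m : R -> R) :
  continuity m ->
  (forall y, exists k : R -> R, (forall x, k x <= m x) /\ k y = m y /\ is_derive k y 0) ->
  forall x y, m x = m y.
Proof.
  intros C S.
  assert (S' : forall eps, 0 < eps -> forall y, exists d, 0 < d /\
     forall x, Rabs (x - y) < d -> m y - eps * Rabs (x - y) <= m x).
  { intros eps He y. destruct (S y) as [k [H1 [H2 H3]]].
    apply is_derive_Reals in H3. destruct (H3 eps He) as [d Hd].
    exists d. split; [apply cond_pos|]. intros x Hx.
    destruct (Req_dec x y) as [->|N]. { rewrite Rminus_diag, Rabs_R0. lra. }
    specialize (Hd (x - y) ltac:(lra) Hx). replace (y + (x - y)) with x in Hd by ring.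
    rewrite Rminus_0_r in Hd. unfold Rdiv in Hd. rewrite Rabs_mult, Rabs_inv in Hd.
    assert (P : 0 < Rabs (x - y)) by (apply Rabs_pos_lt; lra).
    apply Rmult_lt_compat_r with (r := Rabs (x - y)) in Hd; auto.
    rewrite Rmult_assoc, Rinv_l, Rmult_1_r in Hd by lra.
    apply Rabs_lt_between in Hd. specialize (H1 x). lra. }
  assert (Key : forall (s : R), s = 1 \/ s = -1 -> forall eps, 0 < eps -> forall a r, 0 <= r ->
     m a - eps * r <= m (a + s * r)).
  { intros s Hs eps He a r Hr.
    assert (AS : forall q, Rabs (s * q) = Rabs q).
    { intros q. rewrite Rabs_mult. destruct Hs as [-> | ->];
        [rewrite Rabs_R1 | rewrite Rabs_m1]; ring. }
    (* Continuous induction: [E] contains its supremum because [m] is continuous, and the local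
       bound [S'] pushes the supremum up to [r]. *)
    set (E := fun q => 0 <= q <= r /\ m a - eps * q <= m (a + s * q)).
    assert (E0 : E 0). { split; [lra|]. rewrite !Rmult_0_r, Rplus_0_r. lra. }
    destruct (completeness E) as [z [Hu Hl]].
    { exists r. intros q [Hq _]; lra. } { now exists 0. }
    assert (Hz : 0 <= z <= r). { split; [now apply Hu | apply Hl; intros q [Hq _]; lra]. }
    assert (Ez : m a - eps * z <= m (a + s * z)).
    { destruct (Rle_dec (m a - eps * z) (m (a + s * z))) as [|N]; auto. exfalso.
      set (gp := fun q => m (a + s * q) - m a + eps * q).
      assert (Cg : continuity_pt gp z).
      { unfold gp. apply continuity_pt_plus; [apply continuity_pt_minus|].
        - apply (continuity_pt_comp (fun q => a + s * q) m); [|apply C].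
          apply continuity_pt_plus; [apply continuity_pt_const; now intros ? ?|].
          apply continuity_pt_scal, continuity_pt_id.
        - apply continuity_pt_const; now intros ? ?.
        - apply continuity_pt_scal, continuity_pt_id. }
      assert (Ng : gp z < 0) by (unfold gp; lra).
      destruct (Cg (- gp z)) as [d [Hd Hd']]; [lra|].
      assert (z <= z - d / 2 -> False) by lra. apply H, Hl.
      intros q [Hq1 Hq2]. destruct (Rle_dec q (z - d / 2)) as [|Nq]; auto. exfalso.
      assert (q <= z) by (apply Hu; split; auto).
      destruct (Req_dec q z) as [->|Nz]; [unfold gp in Ng; lra|].
      assert (A : Rabs (gp q - gp z) < - gp z).
      { apply Hd'. split; [split; [exact I|auto]|]. simpl; unfold Rdist.
        rewrite Rabs_left1; lra. }
      apply Rabs_lt_between in A. unfold gp in *; lra. }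
    destruct (Req_dec z r) as [<-|Nr]; auto.
    exfalso. destruct (S' eps He (a + s * z)) as [d [Hd Hd']].
    set (t := Rmin (d / 2) (r - z)).
    assert (Ht : 0 < t) by (unfold t; apply Rmin_glb_lt; lra).
    assert (Ht1 : t <= d / 2) by apply Rmin_l. assert (Ht2 : t <= r - z) by apply Rmin_r.
    assert (z + t <= z); [|lra]. apply Hu. split; [lra|].
    specialize (Hd' (a + s * (z + t))).
    replace (a + s * (z + t) - (a + s * z)) with (s * t) in Hd' by ring.
    rewrite AS, (Rabs_pos_eq t) in Hd' by lra. specialize (Hd' ltac:(lra)). lra. }
  assert (W : forall x y, m x <= m y).
  { intros x y. apply Rnot_lt_le. intros N.
    set (r := Rabs (y - x)). assert (Hr : 0 <= r) by apply Rabs_pos.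
    set (eps := (m x - m y) / (r + 1) / 2).
    assert (He : 0 < eps). { unfold eps. apply Rdiv_lt_0_compat; [|lra]. apply Rdiv_lt_0_compat; lra. }
    assert (K : m x - eps * r <= m y).
    { destruct (Rle_dec x y) as [H|H].
      - specialize (Key 1 (or_introl eq_refl) eps He x r Hr).
        replace (x + 1 * r) with y in Key; auto. unfold r. rewrite Rabs_pos_eq; lra.
      - specialize (Key (-1) (or_intror eq_refl) eps He x r Hr).
        replace (x + -1 * r) with y in Key; auto. unfold r. rewrite Rabs_left; lra. }
    assert (eps * (r + 1) = (m x - m y) / 2) by (unfold eps; field; lra).
    assert (eps * r <= eps * (r + 1)) by (apply Rmult_le_compat_l; lra). lra. }
  intros x y. apply Rle_antisym; apply W.
Qed.

Lemma sin_period_2PI s : sin (s + 2 * PI) = sin s.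
Proof. replace (s + 2 * PI) with (s + 2 * INR 1 * PI) by (simpl; ring). apply sin_period. Qed.

Lemma cos_period_2PI s : cos (s + 2 * PI) = cos s.
Proof. replace (s + 2 * PI) with (s + 2 * INR 1 * PI) by (simpl; ring). apply cos_period. Qed.

(** Extends data on [[0, l]] to the whole line, so that continuity can be stated at every point
    without side conditions. *)
Definition clamp (l y : R) : R := Rmax 0 (Rmin l y).

Lemma clamp_id l y : 0 <= y <= l -> clamp l y = y.
Proof. intros H. unfold clamp. rewrite Rmin_right, Rmax_right; lra. Qed.

Lemma clamp_range l y : 0 <= l -> 0 <= clamp l y <= l.
Proof.
  intros H. unfold clamp. split; [apply Rmax_l|].
  apply Rmax_lub; [lra | apply Rmin_l].
Qed.

Lemma continuity_clamp l : continuity (clamp l).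
Proof.
  intros y. apply continuity_pt_filterlim, filterlim_locally. intros eps. exists eps.
  intros u Hu. apply Rle_lt_trans with (2 := Hu).
  change (Rabs (clamp l u - clamp l y) <= Rabs (u - y)).
  unfold clamp, Rmax, Rmin, Rabs.
  repeat destruct Rle_dec; repeat destruct Rcase_abs; lra.
Qed.

(** An implicit function theorem using monotonicity only. In the applications [A] and [B] are the
    heights of the curve on the two sides of a point of tangency, where the derivative of [A]
    vanishes, so the differentiable version would fail there. *)
Lemma exists_matching (A B : R -> R -> R) (l : R) :
  0 < l ->
  (forall x y, continuity_2d_pt A x y) -> (forall x y, continuity_2d_pt B x y) ->
  (forall x y1 y2, 0 <= y1 -> y1 < y2 -> y2 <= l -> A x y1 < A x y2) ->
  (forall x y, 0 <= y <= l -> A x 0 <= B x y <= A x l) ->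
  exists tau : R -> R -> R, (forall x y, continuity_2d_pt tau x y) /\
    forall x y, 0 <= y <= l -> 0 <= tau x y <= l /\ A x (tau x y) = B x y.
Proof.
  intros Hl CA CB MA RB.
  assert (T : forall x y, {z | 0 <= z <= l /\ A x z - B x (clamp l y) = 0}).
  { intros x y. apply (IVT_cor (fun z => A x z - B x (clamp l y))).
    - intros z. apply continuity_pt_minus; [apply continuity_2d_pt_slice2, CA|].
      apply continuity_pt_const. now intros ? ?.
    - lra.
    - specialize (RB x (clamp l y) (clamp_range l y ltac:(lra))).
      assert (0 <= (B x (clamp l y) - A x 0) * (A x l - B x (clamp l y)))
        by (apply Rmult_le_pos; lra). lra. }
  set (tau := fun x y => proj1_sig (T x y)).
  assert (HT : forall x y, 0 <= tau x y <= l /\ A x (tau x y) = B x (clamp l y)).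
  { intros x y. unfold tau. destruct (T x y) as [z [H1 H2]]; simpl. split; auto; lra. }
  exists tau. split.
  2:{ intros x y Hy. destruct (HT x y) as [H1 H2]. rewrite clamp_id in H2; auto. }
  intros x y eps.
  destruct (HT x y) as [Hr He]. set (z := tau x y) in *.
  assert (CBc : continuity_2d_pt (fun u v => B u (clamp l v)) x y).
  { apply (continuity_2d_pt_comp B (fun u v => u) (fun u v => clamp l v)); [apply CB | apply continuity_2d_pt_id1|].
    apply (continuity_1d_2d_pt_comp (clamp l) (fun u v => v)); [apply continuity_clamp | apply continuity_2d_pt_id2]. }
  assert (CAz : forall c, continuity_2d_pt (fun u v => A u c) x y).
  { intros c. apply (continuity_2d_pt_comp A (fun u v => u) (fun u v => c));
      [apply CA | apply continuity_2d_pt_id1 | apply continuity_2d_pt_const]. }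
  assert (MAle : forall u z1 z2, 0 <= z1 -> z1 <= z2 -> z2 <= l -> A u z1 <= A u z2).
  { intros u z1 z2 H0 H1 H2. destruct (Req_dec z1 z2) as [->|N]; [lra|].
    left. apply MA; lra. }
  (* Since [A u] is increasing, bounding [tau u v] amounts to comparing [A u (z + eps)] with the
     target value, which is an open condition. If [z + eps] exceeds [l], the range of [tau]
     suffices. *)
  assert (Up : locally_2d (fun u v => tau u v < z + eps) x y).
  { destruct (Rle_dec (z + eps) l) as [H|H].
    2:{ apply locally_2d_forall. intros u v. destruct (HT u v). lra. }
    pose proof (continuity_2d_pt_minus _ _ _ _ (CAz (z + eps)) CBc) as CC.
    pose proof (cond_pos eps).
    assert (P : 0 < A x (z + eps) - B x (clamp l y)) by (specialize (MA x z (z + eps) ltac:(lra) ltac:(lra) ltac:(lra)); lra).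
    generalize (CC (mkposreal _ P)). apply locally_2d_impl, locally_2d_forall. simpl.
    intros u v Q. apply Rabs_lt_between in Q. destruct (HT u v) as [R1 R2].
    apply Rnot_le_lt. intros N. specialize (MAle u (z + eps) (tau u v) ltac:(lra) N ltac:(lra)). lra. }
  assert (Dn : locally_2d (fun u v => z - eps < tau u v) x y).
  { destruct (Rle_dec 0 (z - eps)) as [H|H].
    2:{ apply locally_2d_forall. intros u v. destruct (HT u v). lra. }
    pose proof (continuity_2d_pt_minus _ _ _ _ CBc (CAz (z - eps))) as CC.
    pose proof (cond_pos eps).
    assert (P : 0 < B x (clamp l y) - A x (z - eps)) by (specialize (MA x (z - eps) z ltac:(lra) ltac:(lra) ltac:(lra)); lra).
    generalize (CC (mkposreal _ P)). apply locally_2d_impl, locally_2d_forall. simpl.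
    intros u v Q. apply Rabs_lt_between in Q. destruct (HT u v) as [R1 R2].
    apply Rnot_le_lt. intros N. specialize (MAle u (tau u v) (z - eps) ltac:(lra) N ltac:(lra)). lra. }
  generalize (locally_2d_and _ _ _ _ Up Dn). apply locally_2d_impl, locally_2d_forall.
  intros u v [H1 H2]. apply Rabs_lt_between. lra.
Qed.

(** * Wirtinger's inequality with Dirichlet conditions *)

(** Controls the poles of the cotangent. The constant comes from [cos >= 1 / 2] on [[0, 1]], as
    [1 < PI / 3]. *)
Lemma sin_abs_ge_half s : Rabs s <= 1 -> Rabs s / 2 <= Rabs (sin s).
Proof.
  enough (W : forall s, 0 <= s <= 1 -> s / 2 <= sin s).
  { intros H. unfold Rabs in *. destruct (Rcase_abs s) as [N|N].
    - specialize (W (- s) ltac:(lra)). rewrite sin_neg in W.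
      destruct Rcase_abs; lra.
    - specialize (W s ltac:(lra)). destruct Rcase_abs; lra. }
  clear s. intros s Hs. destruct (Req_dec s 0) as [->|N]. { rewrite sin_0; lra. }
  destruct (MVT_cor2 sin cos 0 s) as [c [E Hc]]; [lra | intros; apply derivable_pt_lim_sin|].
  rewrite sin_0, !Rminus_0_r in E. rewrite E.
  assert (1 / 2 <= cos c).
  { rewrite <- cos_PI3. pose proof PI2_3_2. apply Rlt_le, cos_decreasing_1; lra. }
  nra.
Qed.

(* [Q x = int_z^x (w'^2 - w^2) - w^2 cot (x - z)] has derivative [(w' - w cot (x - z))^2],
   and its boundary terms vanish at both ends. *)
Lemma wirtinger_half_period (w dw : R -> R) (M z : R) :
  (forall x : R, is_derive w x (dw x)) -> continuity dw -> (forall x, Rabs (dw x) <= M) ->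
  w z = 0 -> w (z + PI) = 0 ->
  let D := RInt (fun x => dw x ^ 2 - w x ^ 2) z (z + PI) in
  0 <= D /\
  (D = 0 -> forall x, z < x < z + PI -> dw x * sin (x - z) = w x * cos (x - z)).
Proof.
  intros Hw Cdw HM Hz0 HzPI D.
  set (f := fun x => dw x ^ 2 - w x ^ 2) in D.
  assert (Cw : continuity w) by (intros x; eapply is_derive_continuity, Hw).
  assert (Cf : continuity f).
  { intros x. unfold f. apply continuity_pt_minus.
    - apply (continuity_pt_comp dw (fun t => t ^ 2)); [apply Cdw|]. apply derivable_continuous_pt. reg.
    - apply (continuity_pt_comp w (fun t => t ^ 2)); [apply Cw|]. apply derivable_continuous_pt. reg. }
  assert (HM0 : 0 <= M). { pose proof (HM 0). pose proof (Rabs_pos (dw 0)). lra. }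
  assert (Lip : forall x p, w p = 0 -> Rabs (w x) <= M * Rabs (x - p)).
  { intros x p Hp. destruct (MVT_gen w p x dw) as [c [_ E]]; auto.
    rewrite Hp, Rminus_0_r in E. rewrite E, Rabs_mult. apply Rmult_le_compat_r; [apply Rabs_pos | apply HM]. }
  set (bd := fun x => w x ^ 2 * (cos (x - z) / sin (x - z))).
  (* At an end [p] one has [|w x| <= M |x - p|] and [|sin| >= |x - p| / 2], so [w^2 cot] is of order
     [|x - p|]. *)
  assert (Bd : forall p, w p = 0 -> (p = z \/ p = z + PI) -> forall x, z < x < z + PI ->
     Rabs (x - p) <= 1 -> Rabs (bd x) <= 2 * M ^ 2 * Rabs (x - p)).
  { intros p Hp Hpp x Hx H1. unfold bd.
    assert (S0 : 0 < sin (x - z)) by (apply sin_gt_0; lra).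
    assert (Sp : Rabs (sin (x - z)) = Rabs (sin (x - p))).
    { destruct Hpp as [-> | ->]; auto.
      replace (x - z) with (x - (z + PI) + PI) by ring. rewrite neg_sin, Rabs_Ropp. auto. }
    pose proof (sin_abs_ge_half _ H1) as S1. rewrite <- Sp, (Rabs_pos_eq (sin _)) in S1 by lra.
    assert (Np : 0 < Rabs (x - p)) by (apply Rabs_pos_lt; destruct Hpp as [-> | ->]; lra).
    pose proof (Lip x p Hp) as L. pose proof (Rabs_pos (w x)).
    rewrite Rabs_mult, <- RPow_abs. unfold Rdiv. rewrite Rabs_mult, Rabs_inv, (Rabs_pos_eq (sin _)) by lra.
    assert (C1 : Rabs (cos (x - z)) <= 1) by (apply Rabs_le; pose proof (COS_bound (x - z)); lra).
    assert (W2 : Rabs (w x) ^ 2 <= (M * Rabs (x - p)) ^ 2) by (apply pow_incr; lra).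
    assert (I : / sin (x - z) <= 2 / Rabs (x - p)).
    { replace (2 / Rabs (x - p)) with (/ (Rabs (x - p) / 2)) by (field; lra).
      apply Rinv_le_contravar; lra. }
    assert (I0 : 0 < / sin (x - z)) by (now apply Rinv_0_lt_compat).
    apply Rle_trans with ((M * Rabs (x - p)) ^ 2 * (1 * (2 / Rabs (x - p)))).
    - apply Rmult_le_compat; auto.
      + apply pow_le; auto.
      + apply Rmult_le_pos; [apply Rabs_pos | lra].
      + apply Rmult_le_compat; auto; [apply Rabs_pos | lra].
    - right. field. lra. }
  set (Q := fun x => RInt f z x - bd x).
  assert (dQ : forall x, z < x < z + PI -> is_derive Q x ((dw x - w x * (cos (x - z) / sin (x - z))) ^ 2)).
  { intros x Hx. assert (S0 : 0 < sin (x - z)) by (apply sin_gt_0; lra).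
    assert (dcot : is_derive (fun x => cos (x - z) / sin (x - z)) x (- 1 - (cos (x - z) / sin (x - z)) ^ 2)).
    { auto_derive; [apply Rgt_not_eq; exact S0|]. change (x + - z) with (x - z). field. lra. }
    unfold Q. eapply is_derive_val.
    - apply (is_derive_minus (fun x => RInt f z x) bd).
      + now apply is_derive_RInt_continuity.
      + unfold bd. apply (is_derive_mult (fun x => w x ^ 2) (fun x => cos (x - z) / sin (x - z))).
        * apply (is_derive_pow w 2). apply Hw.
        * exact dcot.
        * intros; apply Rmult_comm.
    - set (k := cos (x - z) / sin (x - z)). unfold f.
      unfold minus, plus, opp, mult; simpl. ring. }
  assert (Mono : forall a b, z < a -> a < b -> b < z + PI -> Q a <= Q b).
  { intros a b Ha ab Hb.
    destruct (MVT_cor2 Q _ a b ab (fun c Hc => proj1 (is_derive_Reals _ _ _) (dQ c ltac:(lra)))) as [c [E Hc]].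
    pose proof (pow2_ge_0 (dw c - w c * (cos (c - z) / sin (c - z)))). nra. }
  pose proof PI2_3_2 as HPI.
  (* The formula for [Q] has a zero denominator at both ends, so its monotonicity is compared with
     the end values 0 and [D] through limits. *)
  assert (Near : forall p l, w p = 0 -> (p = z \/ p = z + PI) -> RInt f z p = l ->
     forall eps, 0 < eps -> exists d, 0 < d /\ forall x, z < x < z + PI -> Rabs (x - p) < d -> Rabs (Q x - l) < eps).
  { intros p l Hp Hpp Hl eps He.
    pose proof (is_derive_continuity _ _ _ (is_derive_RInt_continuity f z p Cf)) as CI.
    apply continuity_pt_filterlim in CI.
    apply (proj1 (filterlim_locally _ _)) with (eps := mkposreal _ (is_pos_div_2 (mkposreal _ He))) in CI.
    destruct CI as [d1 Hd1]. simpl in Hd1.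
    exists (Rmin d1 (Rmin 1 (eps / (4 * M ^ 2 + 1)))).
    assert (HM2 : 0 <= M ^ 2) by apply pow2_ge_0.
    assert (0 < eps / (4 * M ^ 2 + 1)) by (apply Rdiv_lt_0_compat; lra).
    split. { repeat apply Rmin_glb_lt; try lra. apply cond_pos. }
    intros x Hx Hd. apply Rmin_Rgt_l in Hd. destruct Hd as [Hda Hd].
    apply Rmin_Rgt_l in Hd. destruct Hd as [Hdb Hdc].
    specialize (Hd1 x Hda). change (Rabs (RInt f z x - RInt f z p) < eps / 2) in Hd1.
    rewrite Hl in Hd1.
    pose proof (Bd p Hp Hpp x Hx (Rlt_le _ _ Hdb)) as B1.
    assert (2 * M ^ 2 * Rabs (x - p) <= eps / 2).
    { assert (E : eps / (4 * M ^ 2 + 1) * (4 * M ^ 2 + 1) = eps) by (field; lra).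
      pose proof (Rabs_pos (x - p)). nra. }
    unfold Q. replace (RInt f z x - bd x - l) with ((RInt f z x - l) + - bd x) by ring.
    eapply Rle_lt_trans; [apply Rabs_triang|]. rewrite Rabs_Ropp. lra. }
  assert (N0 := Near z 0 Hz0 (or_introl eq_refl) (RInt_point z f)).
  assert (N1 := Near (z + PI) D HzPI (or_intror eq_refl) eq_refl).
  assert (Low : forall x, z < x < z + PI -> 0 <= Q x).
  { intros x Hx. apply Rnot_lt_le. intros Hn.
    destruct (N0 (- Q x) ltac:(lra)) as [d [Hd Hd']].
    set (t := Rmin d (x - z) / 2).
    assert (0 < Rmin d (x - z)) by (apply Rmin_glb_lt; lra).
    pose proof (Rmin_l d (x - z)). pose proof (Rmin_r d (x - z)).
    specialize (Hd' (z + t) ltac:(unfold t; lra)).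
    replace (z + t - z) with t in Hd' by ring. rewrite (Rabs_pos_eq t) in Hd' by (unfold t; lra).
    specialize (Hd' ltac:(unfold t; lra)). apply Rabs_lt_between in Hd'.
    specialize (Mono (z + t) x ltac:(unfold t; lra) ltac:(unfold t; lra) ltac:(lra)). lra. }
  assert (High : forall x, z < x < z + PI -> Q x <= D).
  { intros x Hx. apply Rnot_lt_le. intros Hn.
    destruct (N1 (Q x - D) ltac:(lra)) as [d [Hd Hd']].
    set (t := Rmin d (z + PI - x) / 2).
    assert (0 < Rmin d (z + PI - x)) by (apply Rmin_glb_lt; lra).
    pose proof (Rmin_l d (z + PI - x)). pose proof (Rmin_r d (z + PI - x)).
    specialize (Hd' (z + PI - t) ltac:(unfold t; lra)).
    replace (z + PI - t - (z + PI)) with (- t) in Hd' by ring.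
    rewrite Rabs_Ropp, (Rabs_pos_eq t) in Hd' by (unfold t; lra).
    specialize (Hd' ltac:(unfold t; lra)). apply Rabs_lt_between in Hd'.
    specialize (Mono x (z + PI - t) ltac:(lra) ltac:(unfold t; lra) ltac:(unfold t; lra)). lra. }
  split.
  - apply Rle_trans with (Q (z + 1)); [apply Low | apply High]; lra.
  - intros D0 x Hx.
    assert (S0 : 0 < sin (x - z)) by (apply sin_gt_0; lra).
    (* If [D = 0], then [Q] is squeezed between 0 and 0, so its derivative, a square, vanishes. *)
    assert (E : (dw x - w x * (cos (x - z) / sin (x - z))) ^ 2 = 0).
    { rewrite <- (is_derive_unique _ _ _ (dQ x Hx)).
      apply is_derive_unique. apply is_derive_ext_loc with (fun _ => 0).
      - assert (P : 0 < Rmin (x - z) (z + PI - x)) by (apply Rmin_glb_lt; lra).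
        exists (mkposreal _ P). intros y Hy. change (Rabs (y - x) < Rmin (x - z) (z + PI - x)) in Hy.
        pose proof (Rmin_l (x - z) (z + PI - x)). pose proof (Rmin_r (x - z) (z + PI - x)).
        apply Rabs_lt_between in Hy.
        apply Rle_antisym; [apply Low; lra | rewrite <- D0; apply High; lra].
      - apply (is_derive_const (V := R_NormedModule)). }
    rewrite <- Rsqr_pow2 in E. apply Rsqr_0_uniq in E.
    replace (dw x) with (w x * (cos (x - z) / sin (x - z))) by lra. field. lra.
Qed.

(** * Locally convex curves parametrized by their tangent angle *)

(* A locally convex curve parametrized by the angle [s] of its oriented tangent;
   [rad] is its radius of curvature. *)
Record strand := {
  px : R -> R;
  py : R -> R;
  rad : R -> R;
  rad_pos : forall s, 0 < rad s;
  rad_continuity : continuity rad;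
  px_derive : forall s : R, is_derive px s (rad s * cos s);
  py_derive : forall s : R, is_derive py s (rad s * sin s)
}.

(* Support function with respect to the outer normal [(sin s, - cos s)]. *)
Definition supp (c : strand) (s : R) : R := px c s * sin s - py c s * cos s.
Definition dsupp (c : strand) (s : R) : R := px c s * cos s + py c s * sin s.

(* Coordinates in the orthonormal frame whose first axis has direction [phi]. *)
Definition along (c : strand) (phi s : R) : R := px c s * cos phi + py c s * sin phi.
Definition height (c : strand) (phi s : R) : R := - px c s * sin phi + py c s * cos phi.

(** Not a field of [strand]: before [turning_number_one] applies, the table is only known to close
    up after some whole number of full turns. *)
Definition closed (c : strand) : Prop :=
  forall s, px c (s + 2 * PI) = px c s /\ py c (s + 2 * PI) = py c s.

(* The chord issued from the point [s] at angle [a] has length [r] and arrives at angle [b]. *)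
Definition chord (c : strand) (s a b r : R) : Prop :=
  0 < r /\ px c (s + a + b) - px c s = r * cos (s + a) /\
  py c (s + a + b) - py c s = r * sin (s + a).

Lemma derive_at_local_max (f : R -> R) a b c l :
  a < c < b -> (forall x, a < x < b -> f x <= f c) -> is_derive f c l -> l = 0.
Proof.
  intros Hc Hm D. apply is_derive_Reals in D.
  set (pr := exist _ l D : derivable_pt f c).
  change l with (derive_pt f c pr).
  apply deriv_maximum with a b; try lra. intros; apply Hm; lra.
Qed.

(** Take the last point where [q <= 0]: a negative derivative there would produce later ones. *)
Lemma exists_upcrossing (q dq : R -> R) a b :
  a < b -> (forall x : R, is_derive q x (dq x)) -> q a < 0 -> 0 < q b ->
  exists z, q z = 0 /\ 0 <= dq z.
Proof.
  intros ab D Ha Hb.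
  set (E := fun x => a <= x <= b /\ q x <= 0).
  destruct (completeness E) as [z [Hu Hl]].
  { exists b. intros x [Hx _]; lra. } { exists a. split; lra. }
  assert (Hz : a <= z <= b). { split; [apply Hu; split; lra | apply Hl; intros x [Hx _]; lra]. }
  assert (C : continuity_pt q z) by (eapply is_derive_continuity, D).
  assert (Z : q z = 0).
  { destruct (Rtotal_order (q z) 0) as [N|[N|N]]; auto; exfalso.
    - destruct (C (- q z)) as [d [Hd Hd']]; [lra|].
      assert (z <> b) by (intros ->; lra).
      set (t := Rmin (d / 2) (b - z)).
      assert (0 < t) by (apply Rmin_glb_lt; lra).
      pose proof (Rmin_l (d / 2) (b - z)). pose proof (Rmin_r (d / 2) (b - z)). fold t in H1, H2.
      assert (A1 : Rabs (q (z + t) - q z) < - q z).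
      { apply Hd'. split; [split; [exact I | lra]|]. simpl; unfold Rdist.
        rewrite Rabs_pos_eq; lra. }
      apply Rabs_lt_between in A1. assert (z + t <= z); [|lra]. apply Hu. split; lra.
    - destruct (C (q z)) as [d [Hd Hd']]; [lra|].
      assert (z <= z - d / 2); [|lra]. apply Hl. intros x [Hx1 Hx2].
      apply Rnot_lt_le. intros Hx. assert (x <= z) by (apply Hu; split; auto).
      assert (x <> z) by (intros ->; lra).
      assert (A1 : Rabs (q x - q z) < q z).
      { apply Hd'. split; [split; [exact I | lra]|]. simpl; unfold Rdist.
        rewrite Rabs_left; lra. }
      apply Rabs_lt_between in A1. lra. }
  exists z. split; auto. apply Rnot_lt_le. intros N.
  pose proof (D z) as Dz. apply is_derive_Reals in Dz.
  destruct (Dz (- dq z)) as [d Hd]; [lra|]. pose proof (cond_pos d).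
  assert (z <> b) by (intros ->; lra).
  set (t := Rmin (d / 2) (b - z)).
  assert (0 < t) by (apply Rmin_glb_lt; lra).
  pose proof (Rmin_l (d / 2) (b - z)). pose proof (Rmin_r (d / 2) (b - z)). fold t in H2, H3.
  specialize (Hd t ltac:(lra) ltac:(rewrite Rabs_pos_eq; lra)).
  apply Rabs_lt_between in Hd. rewrite Z, Rminus_0_r in Hd.
  assert (q (z + t) / t < 0) by lra.
  assert (q (z + t) < 0).
  { replace (q (z + t)) with (q (z + t) / t * t) by (field; lra). nra. }
  assert (z + t <= z); [|lra]. apply Hu. split; lra.
Qed.

Lemma sin_eq_0_lt_PI a : - PI < a < PI -> sin a = 0 -> a = 0.
Proof.
  intros H S. destruct (Rtotal_order a 0) as [N|[N|N]]; auto; exfalso.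
  - assert (sin a < 0) by (apply sin_lt_0_var; lra). lra.
  - assert (0 < sin a) by (apply sin_gt_0; lra). lra.
Qed.

Section Strand.
Context (c : strand).

Lemma px_continuity : continuity (px c).
Proof. intros s. eapply is_derive_continuity, px_derive. Qed.

Lemma py_continuity : continuity (py c).
Proof. intros s. eapply is_derive_continuity, py_derive. Qed.

Lemma supp_derive s : is_derive (supp c) s (dsupp c s).
Proof.
  pose proof (px_derive c s) as X. pose proof (py_derive c s) as Y.
  unfold supp, dsupp. auto_derive.
  - split; [eexists; apply X | split; [eexists; apply Y | auto]].
  - rewrite (is_derive_unique (fun x : R => px c x) _ _ X), (is_derive_unique (fun x : R => py c x) _ _ Y). ring.
Qed.

Lemma dsupp_derive s : is_derive (dsupp c) s (rad c s - supp c s).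
Proof.
  pose proof (px_derive c s) as X. pose proof (py_derive c s) as Y.
  unfold supp, dsupp. auto_derive.
  - split; [eexists; apply X | split; [eexists; apply Y | auto]].
  - rewrite (is_derive_unique (fun x : R => px c x) _ _ X), (is_derive_unique (fun x : R => py c x) _ _ Y).
    generalize (sin2_cos2 s). unfold Rsqr. intros E.
    transitivity (rad c s * (sin s * sin s + cos s * cos s) - (px c s * sin s - py c s * cos s)); [ring|].
    rewrite E; ring.
Qed.

Lemma along_derive phi s : is_derive (along c phi) s (rad c s * cos (s - phi)).
Proof.
  pose proof (px_derive c s) as X. pose proof (py_derive c s) as Y.
  unfold along. auto_derive.
  - split; [eexists; apply X | split; [eexists; apply Y | auto]].
  - rewrite (is_derive_unique (fun x : R => px c x) _ _ X), (is_derive_unique (fun x : R => py c x) _ _ Y).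
    rewrite cos_minus. ring.
Qed.

Lemma height_derive phi s : is_derive (height c phi) s (rad c s * sin (s - phi)).
Proof.
  pose proof (px_derive c s) as X. pose proof (py_derive c s) as Y.
  unfold height. auto_derive.
  - split; [eexists; apply X | split; [eexists; apply Y | auto]].
  - rewrite (is_derive_unique (fun x : R => px c x) _ _ X), (is_derive_unique (fun x : R => py c x) _ _ Y).
    rewrite sin_minus. ring.
Qed.

Lemma supp_continuity : continuity (supp c).
Proof. intros s. eapply is_derive_continuity, supp_derive. Qed.

Lemma dsupp_continuity : continuity (dsupp c).
Proof. intros s. eapply is_derive_continuity, dsupp_derive. Qed.

Lemma height_increasing phi s1 s2 :
  phi <= s1 -> s1 < s2 -> s2 <= phi + PI -> height c phi s1 < height c phi s2.
Proof.
  intros H1 H2 H3. apply strictly_increasing_of_derive with (fun s => rad c s * sin (s - phi)); auto.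
  - intros; apply height_derive.
  - intros s Hs. apply Rmult_lt_0_compat; [apply rad_pos | apply sin_gt_0; lra].
Qed.

Lemma height_decreasing phi s1 s2 :
  phi - PI <= s1 -> s1 < s2 -> s2 <= phi -> height c phi s2 < height c phi s1.
Proof.
  intros H1 H2 H3. enough (- height c phi s1 < - height c phi s2) by lra.
  apply (strictly_increasing_of_derive (fun s => - height c phi s) (fun s => - (rad c s * sin (s - phi)))); auto.
  - intros s. apply (is_derive_opp (height c phi)), height_derive.
  - intros s Hs. assert (sin (s - phi) < 0) by (apply sin_lt_0_var; lra).
    pose proof (rad_pos c s). nra.
Qed.

Lemma along_increasing phi s1 s2 :
  phi - PI / 2 <= s1 -> s1 < s2 -> s2 <= phi + PI / 2 -> along c phi s1 < along c phi s2.
Proof.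
  intros H1 H2 H3. apply strictly_increasing_of_derive with (fun s => rad c s * cos (s - phi)); auto.
  - intros; apply along_derive.
  - intros s Hs. apply Rmult_lt_0_compat; [apply rad_pos | apply cos_gt_0; lra].
Qed.

Lemma px_frame phi s : px c s = along c phi s * cos phi - height c phi s * sin phi.
Proof.
  unfold along, height. generalize (sin2_cos2 phi). unfold Rsqr. intros E.
  transitivity (px c s * (sin phi * sin phi + cos phi * cos phi)); [rewrite E|]; ring.
Qed.

Lemma py_frame phi s : py c s = along c phi s * sin phi + height c phi s * cos phi.
Proof.
  unfold along, height. generalize (sin2_cos2 phi). unfold Rsqr. intros E.
  transitivity (py c s * (sin phi * sin phi + cos phi * cos phi)); [rewrite E|]; ring.
Qed.

Lemma height_2d_continuity_plus x y : continuity_2d_pt (fun phi y => height c phi (phi + y)) x y.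
Proof.
  assert (S : forall x y, continuity_2d_pt (fun u v => u + v) x y)
    by (intros; apply continuity_2d_pt_plus; [apply continuity_2d_pt_id1 | apply continuity_2d_pt_id2]).
  unfold height. apply continuity_2d_pt_plus; apply continuity_2d_pt_mult.
  - apply continuity_2d_pt_opp. apply (continuity_1d_2d_pt_comp (px c)); [apply px_continuity | apply S].
  - apply (continuity_1d_2d_pt_comp sin (fun u v => u)); [apply continuity_sin | apply continuity_2d_pt_id1].
  - apply (continuity_1d_2d_pt_comp (py c)); [apply py_continuity | apply S].
  - apply (continuity_1d_2d_pt_comp cos (fun u v => u)); [apply continuity_cos | apply continuity_2d_pt_id1].
Qed.

Lemma height_2d_continuity_minus x y : continuity_2d_pt (fun phi y => height c phi (phi - y)) x y.
Proof.
  apply continuity_2d_pt_ext with (fun u v => (fun phi y => height c phi (phi + y)) u (- v)).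
  - intros u v. f_equal.
  - apply (continuity_2d_pt_comp (fun phi y => height c phi (phi + y)) (fun u v => u) (fun u v => - v)).
    + apply height_2d_continuity_plus.
    + apply continuity_2d_pt_id1.
    + apply continuity_2d_pt_opp, continuity_2d_pt_id2.
Qed.

(* Seen from the frame of its highest point, the rising and falling sides of the turn
   start in one horizontal order and meet at the top in the opposite one. *)
Lemma full_turn_self_intersects s0 :
  height c s0 (s0 + 2 * PI) = height c s0 s0 ->
  along c s0 s0 < along c s0 (s0 + 2 * PI) ->
  exists s1 s2, s1 < s2 < s1 + 2 * PI /\ px c s1 = px c s2 /\ py c s1 = py c s2.
Proof.
  intros Hh Ha. pose proof PI2_3_2 as HPI. set (phi := s0 + PI).
  assert (Fh : forall s, height c phi s = - height c s0 s).
  { intros s. unfold height, phi. rewrite neg_sin, neg_cos. ring. }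
  assert (Fa : forall s, along c phi s = - along c s0 s).
  { intros s. unfold along, phi. rewrite neg_sin, neg_cos. ring. }
  assert (Ends : height c phi (phi + PI) = height c phi (phi - PI)).
  { rewrite !Fh. replace (phi + PI) with (s0 + 2 * PI) by (unfold phi; ring).
    replace (phi - PI) with s0 by (unfold phi; ring). lra. }
  destruct (exists_matching (fun _ y => height c phi (phi + y)) (fun _ y => height c phi (phi - y)) PI)
    as [tau [Ct Ht]].
  - lra.
  - intros x y. apply (continuity_2d_pt_comp (fun phi y => height c phi (phi + y)) (fun _ _ => phi) (fun u v => v)).
    + apply height_2d_continuity_plus.
    + apply continuity_2d_pt_const.
    + apply continuity_2d_pt_id2.
  - intros x y. apply (continuity_2d_pt_comp (fun phi y => height c phi (phi - y)) (fun _ _ => phi) (fun u v => v)).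
    + apply height_2d_continuity_minus.
    + apply continuity_2d_pt_const.
    + apply continuity_2d_pt_id2.
  - intros _ y1 y2 H1 H2 H3. apply height_increasing; lra.
  - intros _ y Hy. rewrite Rplus_0_r. split.
    + destruct (Req_dec y 0) as [->|N]; [rewrite Rminus_0_r; lra|].
      left. apply height_decreasing; lra.
    + rewrite Ends. destruct (Req_dec y PI) as [->|N]; [lra|].
      left. apply height_decreasing; lra.
  - set (t := tau 0). assert (Ctt : continuity t) by (intros y; apply continuity_2d_pt_slice2, Ct).
    assert (Ht' := Ht 0 : forall y, 0 <= y <= PI -> 0 <= t y <= PI /\
      height c phi (phi + t y) = height c phi (phi - y)). clear Ht Ct.
    assert (t0 : t 0 = 0).
    { destruct (Ht' 0 ltac:(lra)) as [B E]. rewrite Rminus_0_r in E.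
      destruct (Req_dec (t 0) 0) as [|N]; auto.
      assert (height c phi phi < height c phi (phi + t 0)) by (apply height_increasing; lra). lra. }
    assert (tPI : t PI = PI).
    { destruct (Ht' PI ltac:(lra)) as [B E]. rewrite <- Ends in E.
      destruct (Req_dec (t PI) PI) as [|N]; auto.
      assert (height c phi (phi + t PI) < height c phi (phi + PI)) by (apply height_increasing; lra). lra. }
    destruct (Ctt 0 1) as [d [Hd Hd']]; [lra|].
    set (e := Rmin (d / 2) 1).
    assert (He : 0 < e) by (apply Rmin_glb_lt; lra).
    assert (He1 : e <= 1) by apply Rmin_r. assert (He2 : e <= d / 2) by apply Rmin_l.
    assert (te : t e < 1).
    { assert (A1 : Rabs (t e - t 0) < 1).
      { apply Hd'. split; [split; [exact I|lra]|]. simpl; unfold Rdist. rewrite Rabs_pos_eq; lra. }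
      apply Rabs_lt_between in A1. lra. }
    (* Horizontal gap between the two points of equal height. It vanishes at [y = 0], so the
       intermediate value theorem starts from a small [e]; the bounds by 1, below [PI / 2], keep
       both points where [along] is monotone. *)
    set (k := fun y => along c phi (phi - y) - along c phi (phi + t y)).
    assert (Ck : continuity k).
    { assert (Ca : continuity (along c phi)) by (intros s; eapply is_derive_continuity, along_derive).
      intros y. unfold k. apply continuity_pt_minus.
      - apply (continuity_pt_comp (fun y => phi - y) (along c phi)); [|apply Ca].
        apply derivable_continuous_pt. reg.
      - apply (continuity_pt_comp (fun y => phi + t y) (along c phi)); [|apply Ca].
        apply continuity_pt_plus; [apply continuity_pt_const; now intros ? ? | apply Ctt]. }
    destruct (Ht' e ltac:(lra)) as [Bte _].
    assert (ke : k e < 0).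
    { unfold k. assert (along c phi (phi - e) < along c phi (phi + t e)); [|lra].
      apply along_increasing; lra. }
    assert (kPI : 0 < k PI).
    { unfold k. rewrite tPI, !Fa. replace (phi + PI) with (s0 + 2 * PI) by (unfold phi; ring).
      replace (phi - PI) with s0 by (unfold phi; ring). lra. }
    destruct (IVT k e PI Ck ltac:(lra) ke kPI) as [z [Hz Ez]].
    destruct (Ht' z ltac:(lra)) as [Bz Hhz].
    assert (z <> PI) by (intros ->; lra).
    exists (phi - z), (phi + t z). unfold k in Ez.
    split; [lra|]. rewrite !(px_frame phi), !(py_frame phi), Hhz.
    replace (along c phi (phi + t z)) with (along c phi (phi - z)) by lra. auto.
Qed.

(** With at least two turns, compare [supp] at [s] and [s + 2 PI]. Starting at a maximum of [supp]
    the difference is negative, and one turn before its next occurrence it is positive. At an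
    upcrossing the two oriented tangent lines coincide and the later point lies ahead, which is the
    order required by [full_turn_self_intersects]. *)
Lemma turning_number_one (k : nat) :
  (1 <= k)%nat ->
  (forall s, px c (s + INR k * (2 * PI)) = px c s /\ py c (s + INR k * (2 * PI)) = py c s) ->
  (forall s1 s2, s1 < s2 < s1 + INR k * (2 * PI) -> ~ (px c s1 = px c s2 /\ py c s1 = py c s2)) ->
  k = 1%nat.
Proof.
  intros Hk Per Simple. destruct (Nat.eq_dec k 1) as [|Nk]; auto. exfalso.
  pose proof PI2_3_2 as HPI.
  assert (HK : 2 <= INR k) by (change 2 with (INR 2); apply le_INR; lia).
  set (T := INR k * (2 * PI)) in *.
  assert (HT : 4 * PI <= T) by (unfold T; nra).
  assert (ST : forall s, sin (s + T) = sin s /\ cos (s + T) = cos s).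
  { intros s. unfold T. replace (s + INR k * (2 * PI)) with (s + 2 * INR k * PI) by ring.
    split; [apply sin_period | apply cos_period]. }
  assert (S2 : forall s, sin (s + 2 * PI) = sin s /\ cos (s + 2 * PI) = cos s)
    by (intros s; split; [apply sin_period_2PI | apply cos_period_2PI]).
  assert (hT : forall s, supp c (s + T) = supp c s).
  { intros s. unfold supp. destruct (ST s) as [-> ->], (Per s) as [-> ->]. auto. }
  assert (dhT : forall s, dsupp c (s + T) = dsupp c s).
  { intros s. unfold dsupp. destruct (ST s) as [-> ->], (Per s) as [-> ->]. auto. }
  destruct (continuity_ab_maj (supp c) 0 T) as [m [Hm _]]; [lra | intros; apply supp_continuity|].
  assert (Max : forall s, supp c s <= supp c m).
  { intros s. destruct (reduce_mod T ltac:(lra) s) as [n Hn].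
    rewrite <- (periodic_Z (supp c) T hT n s). apply Hm; lra. }
  assert (Crit : forall s, supp c s = supp c m -> dsupp c s = 0).
  { intros s Hs. apply derive_at_local_max with (f := supp c) (a := s - 1) (b := s + 1) (c := s).
    - lra. - intros; rewrite Hs; apply Max. - apply supp_derive. }
  (* [supp] and [dsupp] are the coordinates of the point in the frame at angle [s], and this frame
     is the same one turn later; agreement of both would be a double point. *)
  assert (ND : forall s, supp c (s + 2 * PI) = supp c s -> dsupp c (s + 2 * PI) <> dsupp c s).
  { intros s E1 E2. apply (Simple s (s + 2 * PI)); [lra|].
    unfold supp, dsupp in E1, E2. destruct (S2 s) as [E3 E4]. rewrite E3, E4 in E1, E2.
    generalize (sin2_cos2 s). unfold Rsqr. intros SC.
    set (u := px c (s + 2 * PI)) in *. set (v := py c (s + 2 * PI)) in *.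
    set (u0 := px c s) in *. set (v0 := py c s) in *.
    split.
    - transitivity ((sin s * sin s + cos s * cos s) * u0); [rewrite SC; ring|].
      transitivity ((sin s * sin s + cos s * cos s) * u); [|rewrite SC; ring].
      transitivity (sin s * (u0 * sin s - v0 * cos s) + cos s * (u0 * cos s + v0 * sin s)); [ring|].
      rewrite <- E1, <- E2. ring.
    - transitivity ((sin s * sin s + cos s * cos s) * v0); [rewrite SC; ring|].
      transitivity ((sin s * sin s + cos s * cos s) * v); [|rewrite SC; ring].
      transitivity (sin s * (u0 * cos s + v0 * sin s) - cos s * (u0 * sin s - v0 * cos s)); [ring|].
      rewrite <- E1, <- E2. ring. }
  set (q := fun s => supp c (s + 2 * PI) - supp c s).
  set (dq := fun s => dsupp c (s + 2 * PI) - dsupp c s).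
  assert (Dq : forall s : R, is_derive q s (dq s)).
  { intros s. unfold q, dq. apply (is_derive_minus (fun s => supp c (s + 2 * PI)) (supp c)); [|apply supp_derive].
    eapply is_derive_val; [apply (is_derive_comp (supp c) (fun s => s + 2 * PI)); [apply supp_derive | auto_derive; auto; reflexivity]|].
    apply Rmult_1_l. }
  assert (Q1 : q m < 0).
  { unfold q. pose proof (Max (m + 2 * PI)).
    destruct (Req_dec (supp c (m + 2 * PI)) (supp c m)) as [E|N]; [|lra].
    exfalso. apply (ND m E). rewrite !Crit; auto. }
  assert (Q2 : 0 < q (m + T - 2 * PI)).
  { unfold q. replace (m + T - 2 * PI + 2 * PI) with (m + T) by ring. rewrite hT.
    pose proof (Max (m + T - 2 * PI)).
    destruct (Req_dec (supp c (m + T - 2 * PI)) (supp c m)) as [E|N]; [|lra].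
    exfalso. apply (ND (m + T - 2 * PI)); replace (m + T - 2 * PI + 2 * PI) with (m + T) by ring.
    - rewrite hT; auto. - rewrite dhT, !Crit; auto. }
  destruct (exists_upcrossing q dq m (m + T - 2 * PI) ltac:(lra) Dq Q1 Q2) as [z [Z1 Z2]].
  assert (Z3 : supp c (z + 2 * PI) = supp c z) by (unfold q in Z1; lra).
  pose proof (ND z Z3) as Z4. unfold dq in Z2.
  destruct (full_turn_self_intersects z) as [s1 [s2 [H1 H2]]].
  - unfold supp in Z3. unfold height. destruct (S2 z) as [E3 E4]. rewrite E3, E4 in Z3. lra.
  - unfold dsupp in Z2, Z4. unfold along. destruct (S2 z) as [E3 E4]. rewrite E3, E4 in Z2, Z4. lra.
  - apply (Simple s1 s2); [lra | auto].
Qed.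

End Strand.

(** * Chords of a closed convex curve *)

Section ClosedStrand.
Context (c : strand) (Hc : closed c).

Lemma along_periodic phi s : along c phi (s + 2 * PI) = along c phi s.
Proof. unfold along. destruct (Hc s) as [-> ->]. auto. Qed.

Lemma height_periodic phi s : height c phi (s + 2 * PI) = height c phi s.
Proof. unfold height. destruct (Hc s) as [-> ->]. auto. Qed.

Lemma supp_periodic s : supp c (s + 2 * PI) = supp c s.
Proof. unfold supp. destruct (Hc s) as [-> ->]. now rewrite sin_period_2PI, cos_period_2PI. Qed.

Lemma dsupp_periodic s : dsupp c (s + 2 * PI) = dsupp c s.
Proof. unfold dsupp. destruct (Hc s) as [-> ->]. now rewrite sin_period_2PI, cos_period_2PI. Qed.

(** [closed] speaks of positions only; [rad] is recovered from them as [dsupp' + supp]. *)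
Lemma rad_periodic s : rad c (s + 2 * PI) = rad c s.
Proof.
  assert (E : forall t, is_derive (dsupp c) t (rad c (t + 2 * PI) - supp c t)).
  { intros t. apply is_derive_ext with (fun t => dsupp c (t + 2 * PI)); [intros; apply dsupp_periodic|].
    eapply is_derive_val.
    - apply (is_derive_comp (dsupp c) (fun t => t + 2 * PI)); [apply dsupp_derive | auto_derive; auto; reflexivity].
    - rewrite supp_periodic. apply Rmult_1_l. }
  pose proof (is_derive_unique _ _ _ (E s)) as E1.
  rewrite (is_derive_unique _ _ _ (dsupp_derive c s)) in E1. lra.
Qed.

(** Short arcs stay in the quarter turns around [mu], where [along] increases. For [w > PI / 2] the
    complementary arc, on which [along] decreases, is used instead. *)
Lemma along_mid_chord mu w : 0 < w < PI -> along c mu (mu - w) < along c mu (mu + w).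
Proof.
  intros Hw. pose proof PI2_3_2 as HPI. destruct (Rle_dec w (PI / 2)) as [H|H].
  - apply along_increasing; lra.
  - rewrite <- (along_periodic mu (mu - w)).
    enough (- along c mu (mu + w) < - along c mu (mu - w + 2 * PI)) by lra.
    apply (strictly_increasing_of_derive (fun s => - along c mu s) (fun s => - (rad c s * cos (s - mu)))).
    + lra.
    + intros s. apply (is_derive_opp (along c mu)), along_derive.
    + intros s Hs. assert (cos (s - mu) < 0) by (apply cos_lt_0; lra).
      pose proof (rad_pos c s). nra.
Qed.

(** Strict convexity: the curve lies strictly above each of its tangent lines. Beyond half a turn
    the point is reached from the other side. *)
Lemma height_interior s y : 0 < y - s < 2 * PI ->
  height c s s < height c s y /\ height c y y < height c y s.
Proof.
  intros H. pose proof PI2_3_2 as HPI. split.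
  - destruct (Rle_dec (y - s) PI) as [L|L].
    + apply height_increasing; lra.
    + replace y with (y - 2 * PI + 2 * PI) by ring. rewrite height_periodic.
      apply height_decreasing; lra.
  - destruct (Rle_dec (y - s) PI) as [L|L].
    + apply height_decreasing; lra.
    + rewrite <- (height_periodic y s). apply height_increasing; lra.
Qed.

(** Equal heights make the displacement parallel to the direction [s + a]. Its sign is read off in
    the frame of the middle angle, where [along] grows from [s] to [s + a + b] and which differs
    from [s + a] by [(a - b) / 2], less than a quarter turn. *)
Lemma chord_of_heights s a b : 0 < a < PI -> 0 < b < PI ->
  height c (s + a) (s + a + b) = height c (s + a) s -> exists r, chord c s a b r.
Proof.
  intros Ha Hb E. set (phi := s + a) in *.
  set (r := along c phi (phi + b) - along c phi s).
  assert (X : px c (phi + b) - px c s = r * cos phi).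
  { rewrite !(px_frame c phi), E. unfold r. ring. }
  assert (Y : py c (phi + b) - py c s = r * sin phi).
  { rewrite !(py_frame c phi), E. unfold r. ring. }
  exists r. split; [|split; auto].
  set (mu := s + (a + b) / 2).
  pose proof (along_mid_chord mu ((a + b) / 2) ltac:(lra)) as L.
  replace (mu - (a + b) / 2) with s in L by (unfold mu; ring).
  replace (mu + (a + b) / 2) with (phi + b) in L by (unfold mu, phi; field).
  assert (P : along c mu (phi + b) - along c mu s = r * cos (phi - mu)).
  { rewrite cos_minus. unfold along.
    transitivity ((px c (phi + b) - px c s) * cos mu + (py c (phi + b) - py c s) * sin mu); [ring|].
    rewrite X, Y. ring. }
  assert (0 < cos (phi - mu)) by (apply cos_gt_0; unfold phi, mu; lra).
  apply Rnot_le_lt. intros N. nra.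
Qed.

(** In the frame of the middle angle [mu] the chord points forward, so its direction is [mu + be]
    with [be] an arctangent. The angles [w + be] and [w - be] have positive sine because each end
    lies above the tangent line of the other, and this places them in [(0, PI)]. *)
Lemma chord_between s y : 0 < y - s < 2 * PI ->
  exists a b r, 0 < a < PI /\ 0 < b < PI /\ s + a + b = y /\ chord c s a b r.
Proof.
  intros H. pose proof PI2_3_2 as HPI.
  set (w := (y - s) / 2). set (mu := s + w).
  pose proof (along_mid_chord mu w ltac:(unfold w; lra)) as L.
  replace (mu - w) with s in L by (unfold mu; ring).
  replace (mu + w) with y in L by (unfold mu, w; field).
  destruct (height_interior s y H) as [I1 I2].
  set (u := along c mu y - along c mu s). set (v := height c mu y - height c mu s).
  assert (Hu : 0 < u) by (unfold u; lra).
  set (be := atan (v / u)). pose proof (atan_bound (v / u)) as Bb. fold be in Bb.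
  assert (Hcb : 0 < cos be) by (apply cos_gt_0; lra).
  set (r := u / cos be).
  assert (Hr : 0 < r) by (apply Rdiv_lt_0_compat; auto).
  assert (Eu : u = r * cos be) by (unfold r; field; lra).
  assert (Ev : v = r * sin be).
  { assert (T : tan be = v / u) by apply tan_atan. unfold tan in T.
    replace (sin be) with (v / u * cos be) by (rewrite <- T; field; lra).
    unfold r. field. split; lra. }
  assert (X : px c y - px c s = r * cos (mu + be)).
  { rewrite !(px_frame c mu), cos_plus. unfold u in Eu. unfold v in Ev.
    transitivity ((along c mu y - along c mu s) * cos mu - (height c mu y - height c mu s) * sin mu); [ring|].
    rewrite Eu, Ev. ring. }
  assert (Y : py c y - py c s = r * sin (mu + be)).
  { rewrite !(py_frame c mu), sin_plus. unfold u in Eu. unfold v in Ev.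
    transitivity ((along c mu y - along c mu s) * sin mu + (height c mu y - height c mu s) * cos mu); [ring|].
    rewrite Eu, Ev. ring. }
  assert (Hh : forall phi, height c phi y - height c phi s = r * sin (mu + be - phi)).
  { intros phi. rewrite sin_minus. unfold height.
    transitivity (- (px c y - px c s) * sin phi + (py c y - py c s) * cos phi); [ring|].
    rewrite X, Y. ring. }
  assert (Sa : 0 < sin (w + be)).
  { specialize (Hh s). replace (mu + be - s) with (w + be) in Hh by (unfold mu; ring).
    apply Rnot_le_lt. intros N. nra. }
  assert (Sb : 0 < sin (w - be)).
  { specialize (Hh y). replace (mu + be - y) with (- (w - be)) in Hh by (unfold mu, w; field).
    rewrite sin_neg in Hh. apply Rnot_le_lt. intros N. nra. }
  assert (Range : forall t, w - PI / 2 < t < w + PI / 2 -> 0 < sin t -> 0 < t < PI).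
  { intros t Ht St. unfold w in Ht. split; apply Rnot_le_lt; intros N.
    - assert (sin t <= 0); [|lra]. rewrite <- (Ropp_involutive t), sin_neg.
      pose proof (sin_ge_0 (- t) ltac:(lra) ltac:(lra)). lra.
    - assert (sin t <= 0); [|lra]. apply sin_le_0; lra. }
  exists (w + be), (w - be), r. split; [apply Range; auto; lra|]. split; [apply Range; auto; lra|].
  assert (E : s + (w + be) + (w - be) = y) by (unfold w; field).
  split; auto. unfold chord. rewrite E.
  replace (s + (w + be)) with (mu + be) by (unfold mu; ring). auto.
Qed.

Lemma chord_heights s a b r : chord c s a b r ->
  height c (s + a) (s + a + b) = height c (s + a) s.
Proof.
  intros [_ [X Y]].
  enough (height c (s + a) (s + a + b) - height c (s + a) s = 0) by lra. unfold height.
  transitivity (- (px c (s + a + b) - px c s) * sin (s + a) + (py c (s + a + b) - py c s) * cos (s + a)); [ring|].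
  rewrite X, Y. ring.
Qed.

(** Both chords lie on one line of direction [s + a], and height is injective on the half turn that
    precedes the tangency with that direction. *)
Lemma chord_source_unique s a s' a' b r r' :
  0 < a < PI -> 0 < a' < PI -> s + a = s' + a' ->
  chord c s a b r -> chord c s' a' b r' -> s = s'.
Proof.
  intros Ha Ha' E H H'. apply chord_heights in H, H'. rewrite <- E in H'.
  destruct (Rtotal_order s s') as [L|[L|L]]; auto; exfalso.
  - assert (height c (s + a) s' < height c (s + a) s) by (apply height_decreasing; lra). lra.
  - assert (height c (s + a) s < height c (s + a) s') by (apply height_decreasing; lra). lra.
Qed.

Lemma chord_length s a b r : chord c s a b r ->
  sqrt ((px c (s + a + b) - px c s) ^ 2 + (py c (s + a + b) - py c s) ^ 2) = r.
Proof.
  intros [Hr [-> ->]].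
  replace ((r * cos (s + a)) ^ 2 + (r * sin (s + a)) ^ 2) with (r ^ 2).
  - apply sqrt_pow2; lra.
  - generalize (sin2_cos2 (s + a)). unfold Rsqr. intros E.
    transitivity (r ^ 2 * (sin (s + a) * sin (s + a) + cos (s + a) * cos (s + a))); [rewrite E|]; ring.
Qed.

(* [tau phi a] is the arrival angle of the chord of direction [phi] whose departure angle is [a]. *)
Lemma exists_arrival_angle : exists tau : R -> R -> R,
  (forall x y, continuity_2d_pt tau x y) /\
  (forall phi y, 0 <= y <= PI ->
     0 <= tau phi y <= PI /\ height c phi (phi + tau phi y) = height c phi (phi - y)) /\
  (forall phi, tau phi 0 = 0) /\
  (forall phi y, 0 < y < PI -> 0 < tau phi y < PI) /\
  (forall s a, 0 < a < PI -> exists r, chord c s a (tau (s + a) a) r).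
Proof.
  pose proof PI2_3_2 as HPI.
  assert (Ends : forall phi, height c phi (phi + PI) = height c phi (phi - PI)).
  { intros phi. rewrite <- (height_periodic phi (phi - PI)). f_equal; ring. }
  destruct (exists_matching (fun phi y => height c phi (phi + y)) (fun phi y => height c phi (phi - y)) PI)
    as [tau [Ct Ht]].
  - lra.
  - apply height_2d_continuity_plus.
  - apply height_2d_continuity_minus.
  - intros phi y1 y2 H1 H2 H3. apply height_increasing; lra.
  - intros phi y Hy. rewrite Rplus_0_r. split.
    + destruct (Req_dec y 0) as [->|N]; [rewrite Rminus_0_r; lra|].
      left. apply height_decreasing; lra.
    + rewrite Ends. destruct (Req_dec y PI) as [->|N]; [lra|].
      left. apply height_decreasing; lra.
  - assert (Int : forall phi y, 0 < y < PI -> 0 < tau phi y < PI).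
    { intros phi y Hy. destruct (Ht phi y ltac:(lra)) as [B E].
      assert (height c phi phi < height c phi (phi - y)) by (apply height_decreasing; lra).
      assert (height c phi (phi - y) < height c phi (phi - PI)) by (apply height_decreasing; lra).
      rewrite <- Ends in H0.
      assert (tau phi y <> 0) by (intros T; rewrite T, Rplus_0_r in E; lra).
      assert (tau phi y <> PI) by (intros T; rewrite T in E; lra). lra. }
    exists tau. repeat split; auto; try (intros; apply Ht; auto).
    + intros phi. destruct (Ht phi 0 ltac:(lra)) as [B E]. rewrite Rminus_0_r in E.
      destruct (Req_dec (tau phi 0) 0) as [|N]; auto.
      assert (height c phi phi < height c phi (phi + tau phi 0)) by (apply height_increasing; lra). lra.
    + now apply Int.
    + now apply Int.
    + intros s a Ha. apply chord_of_heights; auto.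
      destruct (Ht (s + a) a ltac:(lra)) as [B E]. rewrite E. f_equal; ring.
Qed.

End ClosedStrand.

(** * Calibration of invariant graphs *)

(** Compactness makes the functions [f w] equicontinuous, so neighbouring maxima can be compared
    although the maximizers may jump. *)
Lemma continuity_max_param (f : R -> R -> R) (m : R -> R) a b :
  (forall w y, continuity_2d_pt f w y) ->
  (forall w y, a <= w <= b -> f w y <= m y) ->
  (forall y, exists w, a <= w <= b /\ f w y = m y) -> continuity m.
Proof.
  intros C U A y. apply continuity_pt_filterlim, filterlim_locally. intros eps.
  destruct (uniform_continuity_2d_1d f a b y (fun w _ => C w y) eps) as [d Hd].
  exists d. intros x Hx. change (Rabs (x - y) < d) in Hx. change (Rabs (m x - m y) < eps).
  pose proof (cond_pos d). apply Rabs_lt_between in Hx.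
  assert (Z : forall w, a <= w <= b -> Rabs (f w x - f w y) < eps).
  { intros w Hw. apply Hd; try lra. rewrite Rminus_diag, Rabs_R0; auto. }
  destruct (A x) as [w1 [W1 E1]], (A y) as [w2 [W2 E2]].
  pose proof (Z w1 W1) as Z1. pose proof (Z w2 W2) as Z2.
  apply Rabs_lt_between in Z1, Z2.
  pose proof (U w1 y W1). pose proof (U w2 x W2). apply Rabs_lt_between. lra.
Qed.

Lemma cos_injective_0_PI a b : 0 <= a <= PI -> 0 <= b <= PI -> cos a = cos b -> a = b.
Proof. intros Ha Hb E. rewrite <- (acos_cos a Ha), <- (acos_cos b Hb). now rewrite E. Qed.

Lemma norm_ge_component u v phi : u * cos phi + v * sin phi <= sqrt (u ^ 2 + v ^ 2).
Proof.
  destruct (Rle_dec (u * cos phi + v * sin phi) 0) as [H|H].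
  - apply Rle_trans with 0; auto. apply sqrt_pos.
  - rewrite <- (sqrt_pow2 (u * cos phi + v * sin phi)) by lra. apply sqrt_le_1_alt.
    generalize (sin2_cos2 phi). unfold Rsqr. intros E.
    assert (I : (u ^ 2 + v ^ 2) * (sin phi * sin phi + cos phi * cos phi) - (u * cos phi + v * sin phi) ^ 2
      = (u * sin phi - v * cos phi) ^ 2) by ring.
    rewrite E in I. pose proof (pow2_ge_0 (u * sin phi - v * cos phi)). lra.
Qed.

Lemma norm_derive (u v : R -> R) du dv r phi t :
  0 < r -> u t = r * cos phi -> v t = r * sin phi ->
  is_derive u t du -> is_derive v t dv ->
  is_derive (fun t => sqrt (u t ^ 2 + v t ^ 2)) t (du * cos phi + dv * sin phi).
Proof.
  intros Hr Eu Ev Du Dv.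
  assert (N : u t ^ 2 + v t ^ 2 = r ^ 2).
  { rewrite Eu, Ev. generalize (sin2_cos2 phi). unfold Rsqr. intros E.
    transitivity (r ^ 2 * (sin phi * sin phi + cos phi * cos phi)); [ring | rewrite E; ring]. }
  assert (P : 0 < u t ^ 2 + v t ^ 2) by (rewrite N; apply pow_lt; auto).
  auto_derive.
  - repeat split; try (eexists; eassumption). 
    replace (u t * (u t * 1) + v t * (v t * 1)) with (u t ^ 2 + v t ^ 2) by ring. exact P.
  - rewrite (is_derive_unique (fun x : R => u x) _ _ Du), (is_derive_unique (fun x : R => v x) _ _ Dv).
    replace (u t * (u t * 1) + v t * (v t * 1)) with (u t ^ 2 + v t ^ 2) by ring.
    rewrite N, sqrt_pow2, Eu, Ev by lra. field. lra.
Qed.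

Definition dist2 (c : strand) (s y : R) : R :=
  sqrt ((px c y - px c s) ^ 2 + (py c y - py c s) ^ 2).

Section Leaf.
Context (c : strand) (Hc : closed c).

Lemma dist2_ge_along phi s y : along c phi y - along c phi s <= dist2 c s y.
Proof.
  unfold dist2. eapply Rle_trans; [|apply (norm_ge_component _ _ phi)].
  unfold along. right; ring.
Qed.

Lemma dist2_self s : dist2 c s s = 0.
Proof. unfold dist2. rewrite !Rminus_diag. replace (0 ^ 2 + 0 ^ 2) with 0 by ring. apply sqrt_0. Qed.

(** First variation of the chord length when both ends move. *)
Lemma dist2_derive (f h : R -> R) t ds dy a b r :
  h t = f t + a + b -> chord c (f t) a b r -> is_derive f t ds -> is_derive h t dy ->
  is_derive (fun t => dist2 c (f t) (h t)) t
    (dy * rad c (h t) * cos b - ds * rad c (f t) * cos a).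
Proof.
  intros Ey [Hr [X Y]] Ds Dy. rewrite <- Ey in X, Y.
  assert (DX : is_derive (fun t => px c (h t) - px c (f t)) t
     (dy * (rad c (h t) * cos (h t)) - ds * (rad c (f t) * cos (f t)))).
  { apply (is_derive_minus (fun t => px c (h t)) (fun t => px c (f t)));
      apply (is_derive_comp (px c)); auto; apply px_derive. }
  assert (DY : is_derive (fun t => py c (h t) - py c (f t)) t
     (dy * (rad c (h t) * sin (h t)) - ds * (rad c (f t) * sin (f t)))).
  { apply (is_derive_minus (fun t => py c (h t)) (fun t => py c (f t)));
      apply (is_derive_comp (py c)); auto; apply py_derive. }
  unfold dist2. eapply is_derive_val.
  - apply (norm_derive _ _ _ _ r (f t + a) t Hr X Y DX DY).
  - replace (cos b) with (cos (h t - (f t + a))) by (f_equal; lra).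
    replace (cos a) with (cos ((f t + a) - f t)) by (f_equal; ring).
    rewrite (cos_minus (h t)), (cos_minus (f t + a)). ring.
Qed.

Context (g : R -> R) (g_continuity : continuity g)
  (g_range : forall s, 0 <= g s <= PI / 2)
  (g_invariant : forall s b r, 0 < g s -> 0 < b < PI -> chord c s (g s) b r -> g (s + g s + b) = b).

(** Primitive along the leaf of [cos a] times arc length, the 1-form for which chord length is the
    generating function of the billiard map. *)
Definition drift (s : R) : R := RInt (fun t => rad c t * cos (g t)) 0 s.

Lemma drift_derive s : is_derive drift s (rad c s * cos (g s)).
Proof.
  apply (is_derive_RInt_continuity (fun t => rad c t * cos (g t))).
  intros t. apply continuity_pt_mult; [apply rad_continuity|].
  apply (continuity_pt_comp g cos); [apply g_continuity | apply continuity_cos].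
Qed.

(** Indexed by the angle [w] between the ends rather than by the source point: the domain of the
    maximization is then independent of [y], and moving [y] turns both ends together. *)
Definition excess (w y : R) : R := dist2 c (y - w) y - (drift y - drift (y - w)).

Lemma excess_continuity w y : continuity_2d_pt excess w y.
Proof.
  assert (S : continuity_2d_pt (fun w y => y - w) w y)
    by (apply continuity_2d_pt_minus; [apply continuity_2d_pt_id2 | apply continuity_2d_pt_id1]).
  assert (T : forall f, continuity f -> continuity_2d_pt (fun w y => f y) w y)
    by (intros f Cf; apply (continuity_1d_2d_pt_comp f (fun u v => v)); [apply Cf | apply continuity_2d_pt_id2]).
  assert (U : forall f, continuity f -> continuity_2d_pt (fun w y => f (y - w)) w y)
    by (intros f Cf; apply (continuity_1d_2d_pt_comp f (fun u v => v - u)); [apply Cf | apply S]).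
  assert (Cd : continuity drift) by (intros s; eapply is_derive_continuity, drift_derive).
  assert (Sq : forall x, continuity_pt (fun t => t ^ 2) x) by (intros; apply derivable_continuous_pt; reg).
  unfold excess. apply continuity_2d_pt_minus.
  - unfold dist2. apply (continuity_1d_2d_pt_comp sqrt).
    + apply continuity_pt_filterlim. apply (continuous_sqrt _).
    + apply continuity_2d_pt_plus; apply (continuity_1d_2d_pt_comp (fun t => t ^ 2)); auto;
        apply continuity_2d_pt_minus; (apply T + apply U); apply px_continuity || apply py_continuity.
  - apply continuity_2d_pt_minus; auto.
Qed.

(** Shortly before [y] the tangent makes with the tangent at [y] an angle smaller than [g], so the
    component of the curve along the tangent at [y] grows faster than [drift]. *)
Lemma excess_positive y : 0 < g y -> exists w, 0 <= w <= 2 * PI /\ 0 < excess w y.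
Proof.
  intros Hg. pose proof PI2_3_2 as HPI.
  destruct (g_continuity y (g y / 2)) as [d [Hd Hd']]; [lra|].
  set (w := Rmin (d / 2) (Rmin (g y / 2) 1)).
  assert (Hw : 0 < w) by (repeat apply Rmin_glb_lt; lra).
  assert (W1 : w <= d / 2) by apply Rmin_l.
  assert (W2 : w <= g y / 2) by (eapply Rle_trans; [apply Rmin_r | apply Rmin_l]).
  assert (W3 : w <= 1) by (eapply Rle_trans; [apply Rmin_r | apply Rmin_r]).
  exists w. split; [lra|]. unfold excess.
  pose proof (dist2_ge_along y (y - w) y) as L.
  enough (along c y (y - w) - drift (y - w) < along c y y - drift y) by lra.
  apply (strictly_increasing_of_derive (fun t => along c y t - drift t)
    (fun t => rad c t * cos (t - y) - rad c t * cos (g t))).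
  - lra.
  - intros t. apply (is_derive_minus (along c y) drift); [apply along_derive | apply drift_derive].
  - intros t Ht.
    assert (A1 : Rabs (g t - g y) < g y / 2).
    { apply Hd'. split; [split; [exact I | lra]|]. simpl; unfold Rdist. rewrite Rabs_left; lra. }
    apply Rabs_lt_between in A1. pose proof (g_range t).
    assert (cos (g t) < cos (t - y)).
    { rewrite <- (cos_neg (t - y)). apply cos_decreasing_1; lra. }
    pose proof (rad_pos c t). nra.
Qed.

(** At an interior maximum the first variation in [w] makes the departure angle equal to [g], and
    invariance then gives the arrival angle. At the ends the chord degenerates and [excess] is at
    most 0, since [g <= PI / 2] makes [drift] nondecreasing; by [excess_positive] this leaves only
    [g y = 0]. *)
Lemma excess_argmax y : exists w, 0 <= w <= 2 * PI /\
  (forall w', 0 <= w' <= 2 * PI -> excess w' y <= excess w y) /\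
  ((g y = 0 /\ excess w y = 0) \/
   (exists b r, 0 < g (y - w) /\ 0 < b < PI /\ y = y - w + g (y - w) + b /\
      chord c (y - w) (g (y - w)) b r /\ g y = b /\ 0 < w < 2 * PI)).
Proof.
  pose proof PI2_3_2 as HPI.
  destruct (continuity_ab_maj (fun w => excess w y) 0 (2 * PI)) as [w [Hm Hw]].
  { lra. } { intros; apply (continuity_2d_pt_slice1 excess), excess_continuity. }
  exists w. split; auto. split; [intros; apply Hm; lra|].
  assert (E0 : excess 0 y = 0).
  { unfold excess. rewrite Rminus_0_r, dist2_self. ring. }
  assert (H0 : 0 <= excess w y) by (rewrite <- E0; apply Hm; lra).
  assert (Dec : 0 < w < 2 * PI \/ excess w y <= 0).
  { destruct (Req_dec w 0) as [->|N1]; [right; lra|].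
    destruct (Req_dec w (2 * PI)) as [->|N2]; [right|left; lra].
    unfold excess. destruct (Hc (y - 2 * PI)) as [X Y].
    replace (y - 2 * PI + 2 * PI) with y in X, Y by ring.
    assert (Z : dist2 c (y - 2 * PI) y = 0).
    { rewrite <- (dist2_self y). unfold dist2. now rewrite X, Y. }
    rewrite Z. destruct (MVT_gen drift (y - 2 * PI) y (fun s => rad c s * cos (g s))) as [t [_ E]].
    - intros; apply drift_derive.
    - intros; eapply is_derive_continuity, drift_derive.
    - pose proof (g_range t). pose proof (rad_pos c t).
      assert (0 <= cos (g t)) by (apply cos_ge_0; lra).
      assert (0 <= rad c t * cos (g t) * (y - (y - 2 * PI))); [|lra].
      apply Rmult_le_pos; [|lra]. apply Rmult_le_pos; lra. }
  destruct Dec as [Hint|Hn].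
  - right. set (s := y - w).
    destruct (chord_between c Hc s y) as [a [b [r [Ha [Hb [Ey Hch]]]]]]; [unfold s; lra|].
    assert (Ds : is_derive (fun w => y - w) w (-1)) by (auto_derive; auto; ring).
    assert (D : is_derive (fun w => excess w y) w (rad c s * cos a - rad c s * cos (g s))).
    { unfold excess. eapply is_derive_val.
      - apply (is_derive_minus (fun w => dist2 c (y - w) y) (fun w => drift y - drift (y - w))).
        + apply (dist2_derive (fun w => y - w) (fun _ => y) w (-1) 0 a b r); auto.
          apply (is_derive_const (V := R_NormedModule)).
        + apply (is_derive_minus (fun _ => drift y) (fun w => drift (y - w))).
          * apply (is_derive_const (V := R_NormedModule)).
          * apply (is_derive_comp drift (fun w => y - w)); [apply drift_derive | exact Ds].
      - unfold minus, plus, opp, scal, zero; simpl; unfold mult; simpl. fold s. ring. }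
    assert (Z : rad c s * cos a - rad c s * cos (g s) = 0).
    { apply (derive_at_local_max (fun w => excess w y) 0 (2 * PI) w); auto. intros; apply Hm; lra. }
    pose proof (rad_pos c s). pose proof (g_range s).
    assert (Ea : a = g s).
    { apply cos_injective_0_PI; try lra. apply Rmult_eq_reg_l with (rad c s); lra. }
    exists b, r. fold s. rewrite Ea in *. clear a Ea.
    split; [lra|]. split; auto. split; auto. split; auto. split; auto.
    rewrite <- Ey. apply g_invariant with r; auto; lra.
  - left. split; [|lra]. destruct (g_range y) as [G _].
    destruct (Req_dec (g y) 0) as [|N]; auto.
    destruct (excess_positive y ltac:(lra)) as [w' [W1 W2]]. specialize (Hm w' W1). simpl in Hm. lra.
Qed.

(** The constant [C0] is the common value of the maxima. It is positive because of [s0], which rules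
    out the degenerate alternative of [excess_argmax] at every point; hence a leaf that touches the
    boundary of the cylinder is contained in it. *)
Lemma leaf_calibrated s0 : 0 < g s0 ->
  (forall s, 0 < g s) /\
  exists C0, (forall s y, s <= y <= s + 2 * PI -> dist2 c s y <= C0 + drift y - drift s) /\
    (forall s b r, 0 < b < PI -> chord c s (g s) b r -> r = C0 + drift (s + g s + b) - drift s).
Proof.
  intros G0. pose proof PI2_3_2 as HPI.
  set (W := fun y => proj1_sig (constructive_indefinite_description _ (excess_argmax y))).
  assert (HW : forall y, 0 <= W y <= 2 * PI /\
    (forall w', 0 <= w' <= 2 * PI -> excess w' y <= excess (W y) y) /\
    ((g y = 0 /\ excess (W y) y = 0) \/
     (exists b r, 0 < g (y - W y) /\ 0 < b < PI /\ y = y - W y + g (y - W y) + b /\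
      chord c (y - W y) (g (y - W y)) b r /\ g y = b /\ 0 < W y < 2 * PI))).
  { intros y. unfold W. apply proj2_sig. }
  clearbody W. set (m := fun y => excess (W y) y).
  assert (E0 : forall y, excess 0 y = 0).
  { intros y. unfold excess. rewrite Rminus_0_r, dist2_self. ring. }
  assert (Cst : forall y, m y = m s0).
  { intros y. apply constant_of_zero_subderivative.
    - apply (continuity_max_param excess m 0 (2 * PI)).
      + apply excess_continuity.
      + intros w x Hw. apply HW; auto.
      + intros x. exists (W x). split; auto. apply HW.
    - clear y. intros y. destruct (HW y) as [Wy [My [[Gy Ey]|[b [r [Ga [Hb [Ey [Hch [Gb Wi]]]]]]]]]].
      + exists (fun _ => 0). split; [|split].
        * intros x. rewrite <- (E0 x). apply HW. lra.
        * unfold m. auto.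
        * apply (is_derive_const (V := R_NormedModule)).
      (* With the optimal [w] frozen, moving [y] turns both ends. Their contributions vanish
         separately, as the angles are [g (y - w)] at departure and [g y] at arrival. *)
      + exists (fun x => excess (W y) x). split; [|split]; auto.
        * intros x. apply HW. auto.
        * set (w := W y) in *. unfold excess.
          assert (Ds : is_derive (fun y => y - w) y 1) by (auto_derive; auto).
          eapply is_derive_val.
          -- apply (is_derive_minus (fun y => dist2 c (y - w) y) (fun y => drift y - drift (y - w))).
             ++ apply (dist2_derive (fun y => y - w) (fun y => y) y 1 1 (g (y - w)) b r); auto.
                apply (is_derive_id (K := R_AbsRing)).
             ++ apply (is_derive_minus drift (fun y => drift (y - w))); [apply drift_derive|].
                apply (is_derive_comp drift (fun y => y - w)); [apply drift_derive | exact Ds].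
          -- rewrite Gb. unfold minus, plus, opp, scal; simpl; unfold mult; simpl. ring. }
  assert (mpos : 0 < m s0).
  { destruct (excess_positive s0 G0) as [w [Hw Pw]]. unfold m.
    eapply Rlt_le_trans; [exact Pw|]. apply HW; auto. }
  assert (Pos : forall s, 0 < g s).
  { intros s. destruct (HW s) as [_ [_ [[_ Z]|[b [r [_ [Hb [_ [_ [Gb _]]]]]]]]]]; [|lra].
    pose proof (Cst s). unfold m in *. lra. }
  split; auto. exists (m s0). split.
  - intros s y Hy. destruct (HW y) as [_ [M _]].
    specialize (M (y - s) ltac:(lra)). fold (m y) in M. rewrite Cst in M.
    unfold excess in M. replace (y - (y - s)) with s in M by ring. lra.
  - intros s b r Hb Hch. set (y := s + g s + b).
    assert (Gy : g y = b) by (apply g_invariant with r; auto).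
    pose proof (Cst y) as Cy. pose proof (Pos y).
    destruct (HW y) as [_ [_ [[Z _]|[b' [r' [Ga' [Hb' [Ey [Hch' [Gb' _]]]]]]]]]]; [lra|].
    rewrite Gy in Gb'. subst b'.
    (* The given chord and the maximizing one arrive at [y] at the same angle [g y], so they have
       the same source; thus equality holds on every chord of the leaf. *)
    assert (Es : s = y - W y).
    { apply (chord_source_unique c s (g s) (y - W y) (g (y - W y)) b r r'); auto.
      - pose proof (g_range s). pose proof (Pos s). lra.
      - pose proof (g_range (y - W y)). lra.
      - unfold y in *. lra. }
    pose proof (chord_length c _ _ _ _ Hch) as L. fold y in L.
    assert (my : m y = r - (drift y - drift s)).
    { unfold m, excess. rewrite <- Es. unfold dist2. now rewrite L. }
    lra.
Qed.

End Leaf.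

(** * The coboundary obtained by turning chords *)

Lemma along_departure c s a : along c (s + a) s = dsupp c s * cos a - supp c s * sin a.
Proof. unfold along, dsupp, supp. rewrite cos_plus, sin_plus. ring. Qed.

Lemma along_arrival c s b : along c (s - b) s = dsupp c s * cos b + supp c s * sin b.
Proof. unfold along, dsupp, supp. rewrite cos_minus, sin_minus. ring. Qed.

Lemma chord_along c s a b r : chord c s a b r -> along c (s + a) (s + a + b) - along c (s + a) s = r.
Proof.
  intros [_ [X Y]]. unfold along.
  generalize (sin2_cos2 (s + a)). unfold Rsqr. intros E.
  transitivity ((px c (s + a + b) - px c s) * cos (s + a) + (py c (s + a + b) - py c s) * sin (s + a)); [ring|].
  rewrite X, Y. transitivity (r * (sin (s + a) * sin (s + a) + cos (s + a) * cos (s + a))); [ring|].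
  rewrite E; ring.
Qed.

Definition invariant_leaf (c : strand) (g : R -> R) : Prop :=
  continuity g /\ (forall s, 0 <= g s <= PI / 2) /\
  (forall s b r, 0 < g s -> 0 < b < PI -> chord c s (g s) b r -> g (s + g s + b) = b).

(** The change of [supp] enters the turned length with coefficient [sin a] at departure and [sin b]
    at arrival. The last summand moves the arrival term into the coboundary and doubles the
    departure term, whence the factor 2 in [shift_inequality]. *)
Definition shift_potential (c : strand) (g : R -> R) (e s : R) : R :=
  drift c g (s + e) - drift c g s - (dsupp c (s + e) - dsupp c s) * cos (g s)
  - (supp c (s + e) - supp c s) * sin (g s).

(* The length of the turned chord is at least its component along the turned direction, and at
   most what the calibration allows. *)
Lemma shift_inequality c g C0 s b r e :
  closed c -> 0 < g s < PI -> 0 < b < PI -> g (s + g s + b) = b ->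
  (forall s y, s <= y <= s + 2 * PI -> dist2 c s y <= C0 + drift c g y - drift c g s) ->
  chord c s (g s) b r -> r = C0 + drift c g (s + g s + b) - drift c g s ->
  2 * sin (g s) * (supp c (s + e) - supp c s) <=
  shift_potential c g e (s + g s + b) - shift_potential c g e s.
Proof.
  intros Hc Ha Hb Gy Hle Hch Hr.
  pose proof (chord_along c _ _ _ _ Hch) as L0. set (y := s + g s + b) in *.
  pose proof (Hle (s + e) (y + e) ltac:(unfold y; lra)) as L1.
  pose proof (dist2_ge_along c (s + e + g s) (s + e) (y + e)) as L2.
  rewrite along_departure in L2, L0.
  replace (s + e + g s) with (y + e - b) in L2 by (unfold y; ring).
  replace (s + g s) with (y - b) in L0 by (unfold y; ring).
  rewrite along_arrival in L2, L0. unfold shift_potential. rewrite Gy. lra.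
Qed.

(** The perimeter, by Cauchy's formula [RInt_rad]. *)
Definition total_width (c : strand) : R := RInt (supp c) 0 (2 * PI).

(** Averages [shift_inequality] over a full turn of [e], which replaces [supp (s + e)] by its
    integral. [Cb] is chosen before the leaf: this uniformity lets the bound hold on the whole
    strip. *)
Lemma leaf_potential c : closed c -> exists Cb, forall g, invariant_leaf c g -> forall s0, 0 < g s0 ->
  (forall s, 0 < g s) /\
  exists Pot : R -> R, (forall s, Rabs (Pot s) <= Cb) /\
    forall s b r, 0 < b < PI -> chord c s (g s) b r ->
      2 * sin (g s) * (total_width c - 2 * PI * supp c s) <= Pot (s + g s + b) - Pot s.
Proof.
  intros Hc. pose proof PI2_3_2 as HPI.
  destruct (periodic_bounded (rad c) (2 * PI)) as [M1 [M1p HM1]];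
    [lra | apply rad_continuity | now apply rad_periodic|].
  destruct (periodic_bounded (supp c) (2 * PI)) as [M2 [M2p HM2]];
    [lra | apply supp_continuity | now apply supp_periodic|].
  destruct (periodic_bounded (dsupp c) (2 * PI)) as [M3 [M3p HM3]];
    [lra | apply dsupp_continuity | now apply dsupp_periodic|].
  (* One term for each difference in [shift_potential]: [drift] over an angle [e <= 2 PI], then
     [dsupp] and [supp], with sines and cosines bounded by 1. *)
  set (M := M1 * (2 * PI) + 2 * M3 + 2 * M2).
  exists (2 * PI * M). intros g [Cg [Rg Ig]] s0 G0.
  destruct (leaf_calibrated c Hc g Cg Rg Ig s0 G0) as [Pos [C0 [Hle Heq]]].
  split; auto.
  assert (Cd : continuity (drift c g)) by (intros s; eapply is_derive_continuity, drift_derive, Cg).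
  assert (Sh : forall f s, continuity f -> continuity (fun e => f (s + e))).
  { intros f s Cf e. apply (continuity_pt_comp (fun e => s + e) f); [|apply Cf].
    apply derivable_continuous_pt. reg. }
  assert (Cc : forall k : R, continuity (fun _ => k)) by (intros k; apply continuity_const; now intros ? ?).
  assert (Cp : forall s, continuity (fun e => shift_potential c g e s)).
  { intros s. unfold shift_potential.
    apply (continuity_minus (fun e => drift c g (s + e) - drift c g s - (dsupp c (s + e) - dsupp c s) * cos (g s))
      (fun e => (supp c (s + e) - supp c s) * sin (g s))).
    - apply (continuity_minus (fun e => drift c g (s + e) - drift c g s) (fun e => (dsupp c (s + e) - dsupp c s) * cos (g s))).
      + apply (continuity_minus (fun e => drift c g (s + e)) (fun _ => drift c g s)); auto.
      + apply (continuity_mult (fun e => dsupp c (s + e) - dsupp c s) (fun _ => cos (g s))); auto.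
        apply (continuity_minus (fun e => dsupp c (s + e)) (fun _ => dsupp c s)); auto.
        apply Sh, dsupp_continuity.
    - apply (continuity_mult (fun e => supp c (s + e) - supp c s) (fun _ => sin (g s))); auto.
      apply (continuity_minus (fun e => supp c (s + e)) (fun _ => supp c s)); auto.
      apply Sh, supp_continuity. }
  exists (fun s => RInt (fun e => shift_potential c g e s) 0 (2 * PI)). split.
  - intros s. replace (2 * PI * M) with ((2 * PI - 0) * M) by ring.
    apply (abs_RInt_le_const (fun e => shift_potential c g e s)).
    + lra.
    + apply ex_RInt_continuity, Cp.
    + intros e He. unfold shift_potential, M.
      assert (B1 : Rabs (drift c g (s + e) - drift c g s) <= M1 * (2 * PI)).
      { destruct (MVT_gen (drift c g) s (s + e) (fun s => rad c s * cos (g s))) as [t [_ E]].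
        - intros; now apply drift_derive.
        - intros; apply Cd.
        - rewrite E, !Rabs_mult. replace (s + e - s) with e by ring. rewrite (Rabs_pos_eq e) by lra.
          pose proof (HM1 t). pose proof (Rabs_pos (rad c t)). pose proof (Rabs_pos (cos (g t))).
          assert (Rabs (cos (g t)) <= 1) by (apply Rabs_le; pose proof (COS_bound (g t)); lra).
          apply Rmult_le_compat; try lra.
          + apply Rmult_le_pos; lra.
          + rewrite <- (Rmult_1_r M1). apply Rmult_le_compat; lra. }
      assert (Dif : forall f m k, (forall x, Rabs (f x) <= m) -> Rabs k <= 1 ->
        Rabs ((f (s + e) - f s) * k) <= 2 * m).
      { intros f m k Hf Hk. rewrite Rabs_mult.
        assert (Rabs (f (s + e) - f s) <= 2 * m).
        { pose proof (Hf (s + e)) as H1. pose proof (Hf s) as H2.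
          apply Rabs_le_between in H1, H2. apply Rabs_le_between. lra. }
        pose proof (Rabs_pos (f (s + e) - f s)). pose proof (Rabs_pos k).
        rewrite <- (Rmult_1_r (2 * m)). apply Rmult_le_compat; lra. }
      assert (B2 := Dif (dsupp c) M3 (cos (g s)) HM3
        ltac:(apply Rabs_le; pose proof (COS_bound (g s)); lra)).
      assert (B3 := Dif (supp c) M2 (sin (g s)) HM2
        ltac:(apply Rabs_le; pose proof (SIN_bound (g s)); lra)).
      apply Rabs_le_between in B1, B2, B3. apply Rabs_le_between. lra.
  - intros s b r Hb Hch. set (y := s + g s + b).
    assert (Gy : g y = b) by (apply Ig with r; auto).
    set (k := 2 * sin (g s)).
    assert (Cl : continuity (fun e => supp c (s + e) - supp c s)).
    { apply (continuity_minus (fun e => supp c (s + e)) (fun _ => supp c s)); auto.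
      apply Sh, supp_continuity. }
    assert (E : RInt (fun e => k * (supp c (s + e) - supp c s)) 0 (2 * PI)
       = k * (total_width c - 2 * PI * supp c s)).
    { transitivity (k * RInt (fun e => supp c (s + e) - supp c s) 0 (2 * PI)).
      { apply (RInt_scal (fun e => supp c (s + e) - supp c s)). now apply ex_RInt_continuity. }
      f_equal.
      transitivity (RInt (fun e => supp c (s + e)) 0 (2 * PI) - RInt (fun _ => supp c s) 0 (2 * PI)).
      { apply (RInt_minus (fun e => supp c (s + e)) (fun _ => supp c s)); apply ex_RInt_continuity; auto.
        apply Sh, supp_continuity. }
      f_equal.
      - unfold total_width. rewrite <- (RInt_shift_periodic (supp c) (2 * PI) s);
          [|apply supp_continuity | now apply supp_periodic].
        apply RInt_ext. intros x _. f_equal. apply Rplus_comm.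
      - rewrite RInt_const. unfold scal; simpl; unfold mult; simpl. now rewrite Rminus_0_r. }
    rewrite <- E.
    assert (E2 : RInt (fun e => shift_potential c g e y - shift_potential c g e s) 0 (2 * PI) =
      RInt (fun e => shift_potential c g e y) 0 (2 * PI) - RInt (fun e => shift_potential c g e s) 0 (2 * PI)).
    { apply (RInt_minus (fun e => shift_potential c g e y) (fun e => shift_potential c g e s));
        apply ex_RInt_continuity, Cp. }
    rewrite <- E2. apply RInt_le.
    + lra.
    + apply ex_RInt_continuity. apply (continuity_scal _ k Cl).
    + apply ex_RInt_continuity. apply (continuity_minus (fun e => shift_potential c g e y)); apply Cp.
    + intros e _. apply (shift_inequality c g C0 s b r e); auto.
      pose proof (Rg s). pose proof (Pos s). lra.
Qed.

(** * The invariant measure of the strip *)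

(* The change of variables [x = t y] only satisfies [A (t y) = B y]; it need not be differentiable
   at the ends, so Cauchy's mean value theorem replaces the chain rule. *)
Lemma RInt_matched_substitution (A dA B dB U t : R -> R) lo hi d1 d2 :
  d1 <= d2 ->
  (forall x : R, is_derive A x (dA x)) -> continuity dA ->
  (forall x : R, is_derive B x (dB x)) -> continuity dB ->
  (forall x, lo < x < hi -> 0 < dA x) ->
  continuity U -> continuity t ->
  (forall y, d1 <= y <= d2 -> lo <= t y <= hi /\ A (t y) = B y) ->
  t d1 = d1 -> t d2 = d2 ->
  RInt (fun y => U (t y) * dB y) d1 d2 = RInt (fun x => U x * dA x) d1 d2.
Proof.
  intros Hd DA CdA DB CdB PA CU Ct Ht Et1 Et2.
  set (Phi := fun x => RInt (fun x => U x * dA x) d1 x).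
  assert (CUA : continuity (fun x => U x * dA x)) by (now apply (continuity_mult U dA)).
  assert (DPhi : forall x, is_derive Phi x (U x * dA x))
    by (intros x; now apply (is_derive_RInt_continuity (fun x => U x * dA x))).
  assert (CPhi : continuity Phi) by (intros x; eapply is_derive_continuity, DPhi).
  assert (CUt : continuity (fun y => U (t y))) by (intros y; apply (continuity_pt_comp t U); [apply Ct | apply CU]).
  assert (CUB : continuity (fun y => U (t y) * dB y)) by (now apply (continuity_mult (fun y => U (t y)) dB)).
  assert (Cauchy : forall x1 x2, lo <= x1 -> x1 < x2 -> x2 <= hi ->
     exists xi, x1 <= xi <= x2 /\ Phi x2 - Phi x1 = U xi * (A x2 - A x1)).
  { intros x1 x2 H1 H2 H3.
    assert (pr1 : forall z, x1 < z < x2 -> derivable_pt Phi z).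
    { intros z _. exists (U z * dA z). apply is_derive_Reals, DPhi. }
    assert (pr2 : forall z, x1 < z < x2 -> derivable_pt A z).
    { intros z _. exists (dA z). apply is_derive_Reals, DA. }
    destruct (MVT Phi A x1 x2 pr1 pr2 H2) as [xi [Hxi E]].
    - intros; apply CPhi.
    - intros; eapply is_derive_continuity, DA.
    - rewrite (derive_pt_eq_0 Phi xi (U xi * dA xi)), (derive_pt_eq_0 A xi (dA xi)) in E;
        try (apply is_derive_Reals; auto).
      exists xi. split; [lra|].
      apply Rmult_eq_reg_r with (dA xi); [|assert (0 < dA xi) by (apply PA; lra); lra].
      lra. }
  assert (Inter : forall y y', d1 <= y <= d2 -> d1 <= y' <= d2 ->
     exists xi, Rabs (xi - t y) <= Rabs (t y' - t y) /\ Phi (t y') - Phi (t y) = U xi * (B y' - B y)).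
  { intros y y' Hy Hy'. destruct (Ht y Hy) as [R1 E1], (Ht y' Hy') as [R2 E2].
    destruct (Rtotal_order (t y) (t y')) as [L|[L|L]].
    - destruct (Cauchy (t y) (t y') ltac:(lra) L ltac:(lra)) as [xi [Hxi E]].
      exists xi. split; [rewrite !Rabs_pos_eq; lra|]. rewrite E, E1, E2; auto.
    - exists (t y). split; [rewrite Rminus_diag, Rabs_R0; apply Rabs_pos|].
      rewrite <- E1, <- E2, L. ring.
    - destruct (Cauchy (t y') (t y) ltac:(lra) L ltac:(lra)) as [xi [Hxi E]].
      exists xi. split; [rewrite !Rabs_left1; lra|]. rewrite E1, E2 in E. lra. }
  assert (DPt : forall y, d1 < y < d2 -> is_derive (fun y => Phi (t y)) y (U (t y) * dB y)).
  { intros y Hy. apply is_derive_Reals. intros eps He.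
    (* The error is at most [e (|dB y| + 1) + |U (t y)| e], which is less than [e k]; the choice of
       [e] makes [e k <= eps / 2]. *)
    set (k := Rabs (U (t y)) + Rabs (dB y) + 2).
    pose proof (Rabs_pos (U (t y))) as P1. pose proof (Rabs_pos (dB y)) as P2.
    set (e := Rmin 1 (eps / (2 * k))).
    assert (Hk : 0 < eps / (2 * k)) by (apply Rdiv_lt_0_compat; unfold k; lra).
    assert (He' : 0 < e) by (apply Rmin_glb_lt; lra).
    assert (e1 : e <= 1) by apply Rmin_l. assert (e2 : e <= eps / (2 * k)) by apply Rmin_r.
    destruct (CU (t y) e He') as [a1 [Ha1 Ha1']].
    destruct (Ct y a1 Ha1) as [a2 [Ha2 Ha2']].
    pose proof (proj1 (is_derive_Reals _ _ _) (DB y)) as DBy.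
    destruct (DBy e He') as [a3 Ha3]. pose proof (cond_pos a3).
    assert (Hdel : 0 < Rmin (Rmin a2 a3) (Rmin (y - d1) (d2 - y))) by (repeat apply Rmin_glb_lt; lra).
    exists (mkposreal _ Hdel). simpl. intros h Hh Hhd.
    apply Rmin_Rgt_l in Hhd. destruct Hhd as [Hd12 Hd34].
    apply Rmin_Rgt_l in Hd12. destruct Hd12 as [Hh2 Hh3].
    apply Rmin_Rgt_l in Hd34. destruct Hd34 as [Hh4 Hh5].
    assert (Hr : d1 <= y + h <= d2).
    { apply Rabs_lt_between in Hh4. apply Rabs_lt_between in Hh5. lra. }
    destruct (Inter y (y + h) ltac:(lra) Hr) as [xi [Hxi E]]. rewrite E.
    assert (T1 : Rabs (t (y + h) - t y) < a1).
    { apply Ha2'. split; [split; [exact I | lra]|]. simpl; unfold Rdist.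
      replace (y + h - y) with h by ring. auto. }
    assert (T2 : Rabs (U xi - U (t y)) <= e).
    { destruct (Req_dec xi (t y)) as [->|N]; [rewrite Rminus_diag, Rabs_R0; lra|].
      left. apply Ha1'. split; [split; [exact I | auto]|]. simpl; unfold Rdist. lra. }
    specialize (Ha3 h Hh Hh3). set (q := (B (y + h) - B y) / h) in *.
    replace (U xi * (B (y + h) - B y) / h - U (t y) * dB y)
      with ((U xi - U (t y)) * q + U (t y) * (q - dB y)) by (unfold q; field; auto).
    eapply Rle_lt_trans; [apply Rabs_triang|]. rewrite !Rabs_mult.
    assert (Q : Rabs q <= Rabs (dB y) + 1).
    { replace q with ((q - dB y) + dB y) by ring. eapply Rle_trans; [apply Rabs_triang|]. lra. }
    pose proof (Rabs_pos q). pose proof (Rabs_pos (U xi - U (t y))). pose proof (Rabs_pos (q - dB y)).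
    assert (Rabs (U xi - U (t y)) * Rabs q <= e * (Rabs (dB y) + 1)) by (apply Rmult_le_compat; lra).
    assert (Rabs (U (t y)) * Rabs (q - dB y) <= Rabs (U (t y)) * e) by (apply Rmult_le_compat; lra).
    assert (e * k <= eps / 2).
    { apply Rle_trans with (eps / (2 * k) * k).
      - apply Rmult_le_compat_r; [unfold k; lra | exact e2].
      - right. field. unfold k; lra. }
    assert (0 < e * 1) by lra.
    unfold k in *. lra. }
  destruct (MVT_gen (fun y => Phi (t y) - RInt (fun y => U (t y) * dB y) d1 y) d1 d2 (fun _ => 0)) as [z [_ E]].
  - rewrite Rmin_left, Rmax_right by lra. intros y Hy.
    apply is_derive_val with (U (t y) * dB y - U (t y) * dB y); [|ring].
    apply (is_derive_minus (fun y => Phi (t y)) (fun y => RInt (fun y => U (t y) * dB y) d1 y)).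
    + now apply DPt.
    + now apply (is_derive_RInt_continuity (fun y => U (t y) * dB y)).
  - intros y _. apply (continuity_pt_minus (fun y => Phi (t y)) (fun y => RInt (fun y => U (t y) * dB y) d1 y)).
    + apply (continuity_pt_comp t Phi); [apply Ct | apply CPhi].
    + eapply is_derive_continuity. now apply (is_derive_RInt_continuity (fun y => U (t y) * dB y)).
  - cbv beta in E. rewrite Et1, Et2 in E.
    replace (Phi d1) with 0 in E by (symmetry; apply (RInt_point d1 (fun x => U x * dA x))).
    replace (RInt (fun y => U (t y) * dB y) d1 d1) with 0 in E
      by (symmetry; apply (RInt_point d1 (fun y => U (t y) * dB y))).
    symmetry. apply Rminus_diag_uniq. change (Phi d2 - RInt (fun y => U (t y) * dB y) d1 d2 = 0). lra.
Qed.

Section Strip.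
Context (c : strand) (Hc : closed c) (tau : R -> R -> R)
  (tau_continuity : forall x y, continuity_2d_pt tau x y)
  (tau_heights : forall phi y, 0 <= y <= PI ->
     0 <= tau phi y <= PI /\ height c phi (phi + tau phi y) = height c phi (phi - y))
  (d1 d2 : R) (d1_nonneg : 0 <= d1) (d1_lt_d2 : d1 < d2) (d2_le_PI : d2 <= PI)
  (tau_d1 : forall phi, tau phi d1 = d1) (tau_d2 : forall phi, tau phi d2 = d2).

Definition next_point (s a : R) : R := s + a + tau (s + a) a.
Definition next_angle (s a : R) : R := tau (s + a) a.

Definition strip_integral (w : R -> R -> R) : R :=
  RInt (fun a => RInt (fun s => w s a * rad c s * sin a) 0 (2 * PI)) d1 d2.

(** Strict monotonicity of the height determines [tau], and the frames [phi] and [phi + 2 PI]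
    coincide. *)
Lemma tau_periodic phi y : 0 <= y <= PI -> tau (phi + 2 * PI) y = tau phi y.
Proof.
  intros Hy. destruct (tau_heights phi y Hy) as [R1 E1], (tau_heights (phi + 2 * PI) y Hy) as [R2 E2].
  assert (P : forall s, height c (phi + 2 * PI) (s + 2 * PI) = height c phi s).
  { intros s. rewrite height_periodic by auto. unfold height.
    now rewrite sin_period_2PI, cos_period_2PI. }
  replace (phi + 2 * PI + tau (phi + 2 * PI) y) with (phi + tau (phi + 2 * PI) y + 2 * PI) in E2 by ring.
  replace (phi + 2 * PI - y) with (phi - y + 2 * PI) in E2 by ring. rewrite !P in E2.
  destruct (Rtotal_order (tau (phi + 2 * PI) y) (tau phi y)) as [L|[L|L]]; auto; exfalso.
  - pose proof (height_increasing c phi (phi + tau (phi + 2 * PI) y) (phi + tau phi y)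
      ltac:(lra) ltac:(lra) ltac:(lra)). lra.
  - pose proof (height_increasing c phi (phi + tau phi y) (phi + tau (phi + 2 * PI) y)
      ltac:(lra) ltac:(lra) ltac:(lra)). lra.
Qed.

Lemma continuity_2d_sum x y : continuity_2d_pt (fun u v => u + v) x y.
Proof. apply continuity_2d_pt_plus; [apply continuity_2d_pt_id1 | apply continuity_2d_pt_id2]. Qed.

Lemma continuity_2d_swap (f : R -> R -> R) :
  (forall x y, continuity_2d_pt f x y) -> forall x y, continuity_2d_pt (fun u v => f v u) x y.
Proof. intros Cf x y eps. destruct (Cf y x eps) as [d H]. exists d. intros; now apply H. Qed.

Lemma next_angle_continuity x y : continuity_2d_pt next_angle x y.
Proof.
  apply (continuity_2d_pt_comp tau (fun s a => s + a) (fun s a => a));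
    [apply tau_continuity | apply continuity_2d_sum | apply continuity_2d_pt_id2].
Qed.

Lemma next_point_continuity x y : continuity_2d_pt next_point x y.
Proof.
  apply (continuity_2d_pt_plus (fun s a => s + a) next_angle);
    [apply continuity_2d_sum | apply next_angle_continuity].
Qed.

Lemma sin_snd_continuity x y : continuity_2d_pt (fun _ a => sin a) x y.
Proof.
  apply (continuity_1d_2d_pt_comp sin (fun _ a => a)); [apply continuity_sin | apply continuity_2d_pt_id2].
Qed.

Lemma rad_comp_continuity (f : R -> R -> R) x y :
  continuity_2d_pt f x y -> continuity_2d_pt (fun u v => rad c (f u v)) x y.
Proof. intros Cf. apply (continuity_1d_2d_pt_comp (rad c)); auto. apply rad_continuity. Qed.

(* In the coordinates (direction, angle) the billiard map fixes the direction, and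
   [rad (phi - a) sin a da] and [rad (phi + b) sin b db] are the same measure on the parallel chords. *)
Lemma strip_integral_invariant (w : R -> R -> R) :
  (forall x y, continuity_2d_pt w x y) ->
  (forall s a, 0 <= a <= PI -> w (s + 2 * PI) a = w s a) ->
  strip_integral (fun s a => w (next_point s a) (next_angle s a)) = strip_integral w.
Proof.
  intros Cw Pw. unfold strip_integral.
  set (F := fun phi a => w (phi + tau phi a) (tau phi a) * rad c (phi - a) * sin a).
  set (G := fun phi b => w (phi + b) b * rad c (phi + b) * sin b).
  assert (CF : forall x y, continuity_2d_pt F x y).
  { intros x y. unfold F. apply continuity_2d_pt_mult; [apply continuity_2d_pt_mult | apply sin_snd_continuity].
    - apply (continuity_2d_pt_comp w (fun phi a => phi + tau phi a) tau); auto.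
      apply continuity_2d_pt_plus; [apply continuity_2d_pt_id1 | apply tau_continuity].
    - apply rad_comp_continuity. apply continuity_2d_pt_minus; [apply continuity_2d_pt_id1 | apply continuity_2d_pt_id2]. }
  assert (CG : forall x y, continuity_2d_pt G x y).
  { intros x y. unfold G. apply continuity_2d_pt_mult; [apply continuity_2d_pt_mult | apply sin_snd_continuity].
    - apply (continuity_2d_pt_comp w (fun phi a => phi + a) (fun _ a => a)); auto;
        [apply continuity_2d_sum | apply continuity_2d_pt_id2].
    - apply rad_comp_continuity, continuity_2d_sum. }
  assert (Dom : forall a, Rmin d1 d2 < a < Rmax d1 d2 -> 0 <= a <= PI).
  { intros a Ha. rewrite Rmin_left, Rmax_right in Ha by lra. lra. }
  (* For fixed [a], passing from [s] to the direction [phi = s + a] is a translation of the circle;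
     the inverse passage at the end uses [phi = s - b], in the sense that the arrival point is
     [phi + b]. *)
  transitivity (RInt (fun a => RInt (fun phi => F phi a) 0 (2 * PI)) d1 d2).
  { apply RInt_ext. intros a Ha. apply Dom in Ha.
    rewrite <- (RInt_shift_periodic (fun phi => F phi a) (2 * PI) a).
    - apply RInt_ext. intros s _. unfold F, next_point, next_angle.
      replace (s + a - a) with s by ring. auto.
    - intros phi. apply (continuity_2d_pt_slice1 F), CF.
    - intros phi. unfold F. rewrite tau_periodic by auto.
      replace (phi + 2 * PI + tau phi a) with (phi + tau phi a + 2 * PI) by ring.
      replace (phi + 2 * PI - a) with (phi - a + 2 * PI) by ring.
      rewrite (rad_periodic c Hc), Pw; auto. apply tau_heights; auto. }
  rewrite (RInt_fubini (fun a phi => F phi a)) by (apply continuity_2d_swap, CF).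
  transitivity (RInt (fun phi => RInt (fun b => G phi b) d1 d2) 0 (2 * PI)).
  { apply RInt_ext. intros phi _.
    transitivity (RInt (fun y => (fun b => w (phi + b) b) (tau phi y) * (rad c (phi - y) * sin y)) d1 d2).
    { apply RInt_ext_all. intros; unfold F. ring. }
    transitivity (RInt (fun b => (fun b => w (phi + b) b) b * (rad c (phi + b) * sin b)) d1 d2).
    2:{ apply RInt_ext_all. intros; unfold G. ring. }
    apply (RInt_matched_substitution (fun y => height c phi (phi + y)) (fun y => rad c (phi + y) * sin y)
       (fun y => height c phi (phi - y)) (fun y => rad c (phi - y) * sin y)
       (fun b => w (phi + b) b) (tau phi) 0 PI).
    - lra.
    - intros y. eapply is_derive_val.
      + apply (is_derive_compose (height c phi) (fun y => phi + y) y (rad c (phi + y) * sin (phi + y - phi)) 1); [apply height_derive | auto_derive; auto].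
      + replace (phi + y - phi) with y by ring. ring.
    - intros y. apply (continuity_2d_pt_slice2 (fun phi y => rad c (phi + y) * sin y)).
      apply continuity_2d_pt_mult; [apply rad_comp_continuity, continuity_2d_sum | apply sin_snd_continuity].
    - intros y. eapply is_derive_val.
      + apply (is_derive_compose (height c phi) (fun y => phi - y) y (rad c (phi - y) * sin (phi - y - phi)) (-1)); [apply height_derive | auto_derive; auto; ring].
      + replace (phi - y - phi) with (- y) by ring. rewrite sin_neg. ring.
    - intros y. apply (continuity_2d_pt_slice2 (fun phi y => rad c (phi - y) * sin y)).
      apply continuity_2d_pt_mult; [apply rad_comp_continuity | apply sin_snd_continuity].
      apply continuity_2d_pt_minus; [apply continuity_2d_pt_id1 | apply continuity_2d_pt_id2].
    - intros y Hy. apply Rmult_lt_0_compat; [apply rad_pos | apply sin_gt_0; lra].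
    - intros b. apply (continuity_2d_pt_slice2 (fun phi b => w (phi + b) b)).
      apply (continuity_2d_pt_comp w (fun phi a => phi + a) (fun _ a => a)); auto;
        [apply continuity_2d_sum | apply continuity_2d_pt_id2].
    - intros y. apply continuity_2d_pt_slice2, tau_continuity.
    - intros y Hy. apply tau_heights; lra.
    - apply tau_d1.
    - apply tau_d2. }
  rewrite (RInt_fubini G) by apply CG.
  apply RInt_ext. intros a Ha. apply Dom in Ha.
  transitivity (RInt (fun s => (fun s => w s a * rad c s * sin a) (s + a)) 0 (2 * PI)).
  { apply RInt_ext. intros; unfold G. auto. }
  apply (RInt_shift_periodic (fun s => w s a * rad c s * sin a)).
  - intros s. apply (continuity_2d_pt_slice1 (fun s a => w s a * rad c s * sin a)).
    apply continuity_2d_pt_mult; [apply continuity_2d_pt_mult; auto | apply sin_snd_continuity].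
    apply rad_comp_continuity, continuity_2d_pt_id1.
  - intros s. rewrite Pw by auto. now rewrite (rad_periodic c Hc).
Qed.

Fixpoint birkhoff_sum (u : R -> R -> R) (n : nat) (s a : R) : R :=
  match n with
  | O => 0
  | S n => u s a + birkhoff_sum u n (next_point s a) (next_angle s a)
  end.

Lemma birkhoff_sum_continuity u : (forall x y, continuity_2d_pt u x y) ->
  forall n x y, continuity_2d_pt (birkhoff_sum u n) x y.
Proof.
  intros Cu n. induction n as [|n IH]; intros x y; simpl.
  - apply continuity_2d_pt_const.
  - apply continuity_2d_pt_plus; auto.
    apply (continuity_2d_pt_comp (birkhoff_sum u n) next_point next_angle);
      [apply IH | apply next_point_continuity | apply next_angle_continuity].
Qed.

Lemma birkhoff_sum_periodic u : (forall s a, 0 <= a <= PI -> u (s + 2 * PI) a = u s a) ->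
  forall n s a, 0 <= a <= PI -> birkhoff_sum u n (s + 2 * PI) a = birkhoff_sum u n s a.
Proof.
  intros Pu n. induction n as [|n IH]; intros s a Ha; simpl; auto.
  rewrite Pu by auto. f_equal.
  assert (N : next_angle (s + 2 * PI) a = next_angle s a).
  { unfold next_angle. replace (s + 2 * PI + a) with (s + a + 2 * PI) by ring. now apply tau_periodic. }
  rewrite N. replace (next_point (s + 2 * PI) a) with (next_point s a + 2 * PI).
  - apply IH. apply tau_heights; auto.
  - unfold next_point. fold (next_angle (s + 2 * PI) a). rewrite N. unfold next_angle. ring.
Qed.

Lemma strip_density_continuity w : (forall x y, continuity_2d_pt w x y) ->
  forall a s, continuity_2d_pt (fun a s => w s a * rad c s * sin a) a s.
Proof.
  intros Cw. apply (continuity_2d_swap (fun s a => w s a * rad c s * sin a)). intros s a.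
  apply continuity_2d_pt_mult; [apply continuity_2d_pt_mult; auto | apply sin_snd_continuity].
  apply rad_comp_continuity, continuity_2d_pt_id1.
Qed.

Lemma strip_inner_continuity w : (forall x y, continuity_2d_pt w x y) ->
  continuity (fun a => RInt (fun s => w s a * rad c s * sin a) 0 (2 * PI)) /\
  forall a, continuity (fun s => w s a * rad c s * sin a).
Proof.
  intros Cw. split.
  - apply (continuity_RInt_param (fun a s => w s a * rad c s * sin a)).
    now apply strip_density_continuity.
  - intros a s. apply (continuity_2d_pt_slice2 (fun a s => w s a * rad c s * sin a)).
    now apply strip_density_continuity.
Qed.

Lemma strip_integral_plus u v :
  (forall x y, continuity_2d_pt u x y) -> (forall x y, continuity_2d_pt v x y) ->
  strip_integral (fun s a => u s a + v s a) = strip_integral u + strip_integral v.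
Proof.
  intros Cu Cv. destruct (strip_inner_continuity u Cu) as [Cu1 Cu2], (strip_inner_continuity v Cv) as [Cv1 Cv2].
  unfold strip_integral.
  transitivity (RInt (fun a => RInt (fun s => u s a * rad c s * sin a) 0 (2 * PI) +
     RInt (fun s => v s a * rad c s * sin a) 0 (2 * PI)) d1 d2).
  - apply RInt_ext. intros a _.
    transitivity (RInt (fun s => u s a * rad c s * sin a + v s a * rad c s * sin a) 0 (2 * PI)).
    + apply RInt_ext_all. intros; ring.
    + apply (RInt_plus (fun s => u s a * rad c s * sin a) (fun s => v s a * rad c s * sin a));
        apply ex_RInt_continuity; auto.
  - apply (RInt_plus (fun a => RInt (fun s => u s a * rad c s * sin a) 0 (2 * PI))
      (fun a => RInt (fun s => v s a * rad c s * sin a) 0 (2 * PI))); apply ex_RInt_continuity; auto.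
Qed.

Lemma strip_integral_le u v :
  (forall x y, continuity_2d_pt u x y) -> (forall x y, continuity_2d_pt v x y) ->
  (forall s a, d1 <= a <= d2 -> u s a <= v s a) -> strip_integral u <= strip_integral v.
Proof.
  intros Cu Cv H. destruct (strip_inner_continuity u Cu) as [Cu1 Cu2], (strip_inner_continuity v Cv) as [Cv1 Cv2].
  pose proof PI2_3_2 as HPI.
  unfold strip_integral. apply RInt_le; try (apply ex_RInt_continuity; auto); [lra|].
  intros a Ha. apply RInt_le; try (apply ex_RInt_continuity; auto); [lra|].
  intros s _. apply Rmult_le_compat_r; [apply sin_ge_0; lra|].
  apply Rmult_le_compat_r; [apply Rlt_le, rad_pos | apply H; lra].
Qed.

Lemma strip_integral_birkhoff_sum u n : (forall x y, continuity_2d_pt u x y) ->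
  (forall s a, 0 <= a <= PI -> u (s + 2 * PI) a = u s a) ->
  strip_integral (birkhoff_sum u n) = INR n * strip_integral u.
Proof.
  intros Cu Pu. induction n as [|n IH].
  - simpl INR. rewrite Rmult_0_l. simpl. unfold strip_integral.
    transitivity (RInt (fun _ : R => 0) d1 d2).
    + apply RInt_ext. intros a _. transitivity (RInt (fun _ : R => 0) 0 (2 * PI)).
      * apply RInt_ext_all. intros; ring.
      * rewrite RInt_const. apply Rmult_0_r.
    + rewrite RInt_const. apply Rmult_0_r.
  - rewrite S_INR. simpl birkhoff_sum.
    rewrite (strip_integral_plus u (fun s a => birkhoff_sum u n (next_point s a) (next_angle s a))); auto.
    + rewrite (strip_integral_invariant (birkhoff_sum u n)).
      * rewrite IH. ring.
      * now apply birkhoff_sum_continuity.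
      * now apply birkhoff_sum_periodic.
    + intros x y. apply (continuity_2d_pt_comp (birkhoff_sum u n) next_point next_angle);
        [now apply birkhoff_sum_continuity | apply next_point_continuity | apply next_angle_continuity].
Qed.

(** By invariance the sum of [n] terms has integral [n] times that of [u], yet it never exceeds the
    integral of [K]. *)
Lemma strip_integral_nonpos u K : (forall x y, continuity_2d_pt u x y) ->
  (forall s a, 0 <= a <= PI -> u (s + 2 * PI) a = u s a) ->
  (forall n s a, d1 <= a <= d2 -> birkhoff_sum u n s a <= K) ->
  strip_integral u <= 0.
Proof.
  intros Cu Pu H. apply Rnot_lt_le. intros N.
  assert (B : forall n, INR n * strip_integral u <= strip_integral (fun _ _ => K)).
  { intros n. rewrite <- strip_integral_birkhoff_sum by auto. apply strip_integral_le.
    - now apply birkhoff_sum_continuity.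
    - intros; apply continuity_2d_pt_const.
    - auto. }
  destruct (INR_unbounded (strip_integral (fun _ _ => K) / strip_integral u)) as [n Hn].
  specialize (B n). apply Rmult_gt_compat_r with (r := strip_integral u) in Hn; auto.
  unfold Rdiv in Hn. rewrite Rmult_assoc, Rinv_l, Rmult_1_r in Hn by lra. lra.
Qed.

End Strip.

(** * Rigidity *)

(** [rad - supp] is the derivative of the periodic function [dsupp]. *)
Lemma RInt_rad c : closed c -> RInt (rad c) 0 (2 * PI) = total_width c.
Proof.
  intros Hc. unfold total_width.
  assert (Cd : continuity (fun x => rad c x - supp c x))
    by (apply (continuity_minus (rad c) (supp c)); [apply rad_continuity | apply supp_continuity]).
  pose proof (RInt_of_derive (dsupp c) (fun x => rad c x - supp c x) 0 (2 * PI)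
    (fun x => dsupp_derive c x) Cd) as E.
  pose proof (dsupp_periodic c Hc 0) as P. rewrite Rplus_0_l in P. rewrite P in E.
  assert (E2 : RInt (fun x => rad c x - supp c x) 0 (2 * PI) = RInt (rad c) 0 (2 * PI) - RInt (supp c) 0 (2 * PI)).
  { apply (RInt_minus (rad c) (supp c)); apply ex_RInt_continuity; [apply rad_continuity | apply supp_continuity]. }
  apply Rminus_diag_uniq. change (RInt (rad c) 0 (2 * PI) - RInt (supp c) 0 (2 * PI) = 0). lra.
Qed.

Lemma reversed_isoperimetric c d1 d2 :
  closed c -> 0 <= d1 -> d1 < d2 -> d2 <= PI / 2 ->
  (d1 = 0 \/ forall s b r, 0 < b < PI -> chord c s d1 b r -> b = d1) ->
  (forall s b r, 0 < b < PI -> chord c s d2 b r -> b = d2) ->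
  (forall s a, d1 <= a <= d2 -> exists g, invariant_leaf c g /\ g s = a) ->
  total_width c ^ 2 <= 2 * PI * RInt (fun s => supp c s * rad c s) 0 (2 * PI).
Proof.
  intros Hc H1 H12 H2 I1 I2 Fol. pose proof PI2_3_2 as HPI.
  destruct (exists_arrival_angle c Hc) as [tau [Ct [Ht [Ht0 [Hti Htc]]]]].
  assert (T2 : forall phi, tau phi d2 = d2).
  { intros phi. destruct (Htc (phi - d2) d2 ltac:(lra)) as [r Hr].
    replace (phi - d2 + d2) with phi in Hr by ring. apply (I2 (phi - d2) _ r); auto. apply Hti; lra. }
  assert (T1 : forall phi, tau phi d1 = d1).
  { intros phi. destruct (Req_dec d1 0) as [->|N]; [apply Ht0|].
    destruct I1 as [|I1]; [contradiction|].
    destruct (Htc (phi - d1) d1 ltac:(lra)) as [r Hr].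
    replace (phi - d1 + d1) with phi in Hr by ring. apply (I1 (phi - d1) _ r); auto. apply Hti; lra. }
  set (P := total_width c).
  set (u := fun s a => 2 * sin a * (P - 2 * PI * supp c s)).
  assert (Cu : forall x y, continuity_2d_pt u x y).
  { intros x y. unfold u. apply continuity_2d_pt_mult; [apply continuity_2d_pt_mult|].
    - apply continuity_2d_pt_const.
    - apply sin_snd_continuity.
    - apply continuity_2d_pt_minus; [apply continuity_2d_pt_const|].
      apply continuity_2d_pt_mult; [apply continuity_2d_pt_const|].
      apply (continuity_1d_2d_pt_comp (supp c) (fun s _ => s)); [apply supp_continuity | apply continuity_2d_pt_id1]. }
  destruct (leaf_potential c Hc) as [Cb HCb].
  assert (Bound : forall n s a, d1 <= a <= d2 -> birkhoff_sum tau u n s a <= 2 * Rabs Cb).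
  (* Angle 0 lies outside the reach of [leaf_potential]; there the orbit stays at angle 0 and [u]
     vanishes along it. *)
  { intros n s a Ha. destruct (Req_dec a 0) as [->|Na].
    - assert (Z : forall n s, birkhoff_sum tau u n s 0 = 0).
      { clear n s. intros n. induction n as [|n IH]; intros s; simpl; auto.
        unfold next_angle. rewrite Ht0, IH. unfold u. rewrite sin_0. ring. }
      rewrite Z. pose proof (Rabs_pos Cb). lra.
    - destruct (Fol s a Ha) as [g [Lg Eg]].
      destruct (HCb g Lg s ltac:(lra)) as [Pos [Pot [BP HP]]].
      destruct Lg as [_ [Rg Ig]].
      assert (Sum : forall n s, exists s', birkhoff_sum tau u n s (g s) <= Pot s' - Pot s).
      { clear n s Eg. intros n. induction n as [|n IH]; intros s; simpl.
        - exists s. lra.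
        - pose proof (Rg s). pose proof (Pos s).
          destruct (Htc s (g s) ltac:(lra)) as [r Hr].
          pose proof (Hti (s + g s) (g s) ltac:(lra)) as Hb.
          specialize (HP s _ r Hb Hr). pose proof (Ig s _ r ltac:(lra) Hb Hr) as Gn.
          fold (next_point tau s (g s)) in HP, Gn. fold (next_angle tau s (g s)) in Gn.
          destruct (IH (next_point tau s (g s))) as [s' Hs']. rewrite Gn in Hs'.
          exists s'. change (u s (g s) <= Pot (next_point tau s (g s)) - Pot s) in HP. lra. }
      destruct (Sum n s) as [s' Hs']. rewrite Eg in Hs'.
      pose proof (BP s') as B1. pose proof (BP s) as B2. pose proof (Rle_abs Cb).
      apply Rabs_le_between in B1, B2. lra. }
  assert (Pu : forall s a, 0 <= a <= PI -> u (s + 2 * PI) a = u s a).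
  { intros s a _. unfold u. now rewrite (supp_periodic c Hc). }
  pose proof (strip_integral_nonpos c Hc tau Ct Ht d1 d2 H1 H12 ltac:(lra) T1 T2 u _ Cu Pu Bound) as NP.
  assert (Csr : continuity (fun s => supp c s * rad c s))
    by (apply (continuity_mult (supp c) (rad c)); [apply supp_continuity | apply rad_continuity]).
  set (Q := RInt (fun s => supp c s * rad c s) 0 (2 * PI)).
  (* The integrand is [2 sin^2 a] times a function of [s] alone; one of the two factors [P] in
     [P ^ 2] comes from [RInt_rad]. *)
  assert (J : forall a, RInt (fun s => u s a * rad c s * sin a) 0 (2 * PI) = 2 * sin a ^ 2 * (P ^ 2 - 2 * PI * Q)).
  { intros a. set (k := 2 * sin a ^ 2).
    transitivity (RInt (fun s => k * P * rad c s - k * (2 * PI) * (supp c s * rad c s)) 0 (2 * PI)).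
    { apply RInt_ext_all. intros s. unfold u, k. ring. }
    transitivity (RInt (fun s => k * P * rad c s) 0 (2 * PI)
       - RInt (fun s => k * (2 * PI) * (supp c s * rad c s)) 0 (2 * PI)).
    { apply (RInt_minus (fun s => k * P * rad c s) (fun s => k * (2 * PI) * (supp c s * rad c s)));
        apply ex_RInt_continuity; apply continuity_scal; auto. apply rad_continuity. }
    assert (E1 : RInt (fun s => k * P * rad c s) 0 (2 * PI) = k * P * P).
    { transitivity (k * P * RInt (rad c) 0 (2 * PI)).
      - apply (RInt_scal (rad c)). apply ex_RInt_continuity, rad_continuity.
      - now rewrite RInt_rad. }
    assert (E2 : RInt (fun s => k * (2 * PI) * (supp c s * rad c s)) 0 (2 * PI) = k * (2 * PI) * Q).
    { apply (RInt_scal (fun s => supp c s * rad c s)). now apply ex_RInt_continuity. }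
    rewrite E1, E2. assert (E3 : k * P * P - k * (2 * PI) * Q = k * (P ^ 2 - 2 * PI * Q)) by ring. exact E3. }
  apply Rnot_lt_le. intros N. fold P Q in N.
  assert (0 < strip_integral c d1 d2 u); [|lra].
  unfold strip_integral. rewrite (RInt_ext_all _ _ d1 d2 J).
  apply RInt_gt_0; auto.
  - intros a Ha. assert (0 < sin a) by (apply sin_gt_0; lra).
    apply Rmult_lt_0_compat; [|lra]. apply Rmult_lt_0_compat; [lra | now apply pow_lt].
  - intros a _. apply continuous_of_continuity. apply derivable_continuous_pt. reg.
Qed.

Section Rigidity.
Context (c : strand) (Hc : closed c).

(** Wirtinger's inequality for [supp - k]. In the equality case, differentiating the resulting
    identity gives [(rad - k) sin (x - z) = 0]. The end [z] is included by continuity, so that two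
    half turns tile a full turn. *)
Lemma rad_constant_on_half_turn z k :
  supp c z = k -> supp c (z + PI) = k ->
  let D := RInt (fun x => dsupp c x ^ 2 - (supp c x - k) ^ 2) z (z + PI) in
  0 <= D /\ (D = 0 -> forall x, z <= x < z + PI -> rad c x = k).
Proof.
  intros E1 E2 D. pose proof PI2_3_2 as HPI.
  destruct (periodic_bounded (dsupp c) (2 * PI)) as [M [_ HM]];
    [lra | apply dsupp_continuity | now apply dsupp_periodic|].
  destruct (wirtinger_half_period (fun x => supp c x - k) (dsupp c) M z) as [W1 W2].
  - intros x. apply is_derive_val with (dsupp c x - 0); [|ring].
    apply (is_derive_minus (supp c) (fun _ => k)); [apply supp_derive | apply (is_derive_const (V := R_NormedModule))].
  - apply dsupp_continuity.
  - auto.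
  - lra.
  - lra.
  - split; [exact W1|]. intros D0. specialize (W2 D0).
    assert (Open : forall x, z < x < z + PI -> rad c x = k).
    { intros x Hx.
      set (l := fun t => dsupp c t * sin (t - z) - (supp c t - k) * cos (t - z)).
      assert (Dl : is_derive l x ((rad c x - k) * sin (x - z))).
      { unfold l. pose proof (supp_derive c x) as A1. pose proof (dsupp_derive c x) as A2. auto_derive.
        - split; [eexists; apply A2 | split; [eexists; apply A1 | auto]].
        - rewrite (is_derive_unique (fun x : R => dsupp c x) _ _ A2),
            (is_derive_unique (fun x : R => supp c x) _ _ A1). unfold Rminus. ring. }
      assert (Z : (rad c x - k) * sin (x - z) = 0).
      { rewrite <- (is_derive_unique _ _ _ Dl). apply is_derive_unique.
        apply is_derive_ext_loc with (fun _ => 0); [|apply (is_derive_const (V := R_NormedModule))].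
        assert (P : 0 < Rmin (x - z) (z + PI - x)) by (apply Rmin_glb_lt; lra).
        exists (mkposreal _ P). intros y Hy. change (Rabs (y - x) < Rmin (x - z) (z + PI - x)) in Hy.
        pose proof (Rmin_l (x - z) (z + PI - x)). pose proof (Rmin_r (x - z) (z + PI - x)).
        apply Rabs_lt_between in Hy. unfold l. rewrite (W2 y) by lra. symmetry. apply Rminus_diag. }
      assert (0 < sin (x - z)) by (apply sin_gt_0; lra).
      apply Rmult_integral in Z. lra. }
    intros x Hx. destruct (Req_dec (rad c x) k) as [|N]; auto. exfalso.
    destruct (rad_continuity c x (Rabs (rad c x - k))) as [d [Hd Hd']]; [apply Rabs_pos_lt; lra|].
    set (t := Rmin (d / 2) ((z + PI - x) / 2)).
    assert (0 < t) by (apply Rmin_glb_lt; lra).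
    assert (t <= d / 2) by apply Rmin_l. assert (t <= (z + PI - x) / 2) by apply Rmin_r.
    assert (B1 : Rabs (rad c (x + t) - rad c x) < Rabs (rad c x - k)).
    { apply Hd'. split; [split; [exact I | lra]|]. simpl; unfold Rdist. rewrite Rabs_pos_eq; lra. }
    rewrite (Open (x + t)) in B1 by lra. rewrite Rabs_minus_sym in B1. lra.
Qed.

(* Hurwitz' trick: choose [z] with [supp z = supp (z + PI)], so that Wirtinger's inequality with
   Dirichlet conditions applies to both half turns. *)
Lemma rad_constant :
  total_width c ^ 2 <= 2 * PI * RInt (fun s => supp c s * rad c s) 0 (2 * PI) ->
  exists k, forall s, rad c s = k.
Proof.
  intros Iso. pose proof PI2_3_2 as HPI.
  assert (Sh : continuity (fun x => supp c (x + PI))).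
  { intros x. apply (continuity_pt_comp (fun x => x + PI) (supp c)); [|apply supp_continuity].
    apply derivable_continuous_pt. reg. }
  destruct (IVT_cor (fun x => supp c x - supp c (x + PI)) 0 PI) as [z [_ Ez]].
  { apply (continuity_minus (supp c) (fun x => supp c (x + PI))); auto. apply supp_continuity. }
  { lra. }
  { replace (PI + PI) with (0 + 2 * PI) by ring. rewrite (supp_periodic c Hc), Rplus_0_l.
    pose proof (pow2_ge_0 (supp c 0 - supp c PI)). lra. }
  set (k := supp c z).
  assert (Ez2 : supp c (z + PI) = k) by (unfold k; lra).
  assert (Ez3 : supp c (z + PI + PI) = k).
  { replace (z + PI + PI) with (z + 2 * PI) by ring. now rewrite (supp_periodic c Hc). }
  destruct (rad_constant_on_half_turn z k eq_refl Ez2) as [P1 R1].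
  destruct (rad_constant_on_half_turn (z + PI) k Ez2 Ez3) as [P2 R2].
  set (f := fun x => dsupp c x ^ 2 - (supp c x - k) ^ 2) in *.
  set (P := total_width c) in *.
  set (Q := RInt (fun s => supp c s * rad c s) 0 (2 * PI)) in *.
  assert (Csr : continuity (fun s => supp c s * rad c s))
    by (apply (continuity_mult (supp c) (rad c)); [apply supp_continuity | apply rad_continuity]).
  assert (Cf : continuity f).
  { intros x. unfold f. apply continuity_pt_minus.
    - apply (continuity_pt_comp (dsupp c) (fun t => t ^ 2)); [apply dsupp_continuity|].
      apply derivable_continuous_pt. reg.
    - apply (continuity_pt_comp (supp c) (fun t => (t - k) ^ 2)); [apply supp_continuity|].
      apply derivable_continuous_pt. reg. }
  set (A1 := fun x => RInt (supp c) 0 x). set (A2 := fun x => RInt (fun s => supp c s * rad c s) 0 x).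
  (* A primitive of [f], found by integrating [dsupp^2] by parts with [dsupp' = rad - supp]. *)
  set (Th := fun x => supp c x * dsupp c x - A2 x + 2 * k * A1 x - k ^ 2 * x).
  assert (DTh : forall x : R, is_derive Th x (f x)).
  { intros x. unfold Th. pose proof (supp_derive c x) as B1. pose proof (dsupp_derive c x) as B2.
    assert (B3 : is_derive A1 x (supp c x)) by (apply (is_derive_RInt_continuity (supp c)), supp_continuity).
    assert (B4 : is_derive A2 x (supp c x * rad c x))
      by (now apply (is_derive_RInt_continuity (fun s => supp c s * rad c s))).
    clearbody A1 A2. auto_derive.
    - repeat split; try (eexists; eassumption).
    - rewrite (is_derive_unique (fun x : R => supp c x) _ _ B1), (is_derive_unique (fun x : R => dsupp c x) _ _ B2),
        (is_derive_unique (fun x : R => A1 x) _ _ B3), (is_derive_unique (fun x : R => A2 x) _ _ B4).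
      unfold f. ring. }
  assert (E : @eq R (RInt f z (z + 2 * PI)) (- Q + 2 * k * P - 2 * PI * k ^ 2)).
  { rewrite (RInt_of_derive Th f z (z + 2 * PI) DTh Cf). unfold Th.
    rewrite (supp_periodic c Hc), (dsupp_periodic c Hc).
    assert (F1 : A1 (z + 2 * PI) - A1 z = P).
    { unfold P, total_width. rewrite <- (RInt_periodic (supp c) (2 * PI) z (supp_continuity c) (supp_periodic c Hc)).
      unfold A1. pose proof (RInt_add_continuity (supp c) 0 z (z + 2 * PI) (supp_continuity c)).
      apply Rminus_diag_uniq. lra. }
    assert (F2 : A2 (z + 2 * PI) - A2 z = Q).
    { unfold Q. rewrite <- (RInt_periodic (fun s => supp c s * rad c s) (2 * PI) z Csr).
      - unfold A2. pose proof (RInt_add_continuity _ 0 z (z + 2 * PI) Csr). apply Rminus_diag_uniq. lra.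
      - intros x. now rewrite (supp_periodic c Hc), (rad_periodic c Hc). }
    rewrite <- F1, <- F2. ring. }
  replace (z + 2 * PI) with (z + PI + PI) in E by ring.
  pose proof (RInt_add_continuity f z (z + PI) (z + PI + PI) Cf) as Sp.
  pose proof (pow2_ge_0 (P - 2 * PI * k)) as Sq.
  set (D1 := RInt f z (z + PI)) in *. set (D2 := RInt f (z + PI) (z + PI + PI)) in *.
  (* By [E], the left side is [- 2 PI Q + 4 PI k P - 4 PI^2 k^2]; inserting [P^2 <= 2 PI Q] bounds
     it by [- (P - 2 PI k)^2]. *)
  assert (DD : 2 * PI * (D1 + D2) <= 0).
  { rewrite Sp, E. lra. }
  assert (D1 = 0 /\ D2 = 0) as [Z1 Z2] by (split; nra).
  exists k. intros s. destruct (reduce_mod (2 * PI) ltac:(lra) (s - z)) as [n Hn].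
  rewrite <- (periodic_Z (rad c) (2 * PI) (rad_periodic c Hc) n s).
  destruct (Rlt_dec (s - z + IZR n * (2 * PI)) PI).
  - apply R1; auto; lra.
  - apply R2; auto; lra.
Qed.

Lemma circle_of_rad_constant k : (forall s, rad c s = k) ->
  exists x0 y0, forall s, (px c s - x0) ^ 2 + (py c s - y0) ^ 2 = k ^ 2.
Proof.
  (* At [s = 0] the tangent is horizontal, so the centre lies at distance [k] straight above. *)
  intros Hk. exists (px c 0), (py c 0 + k). intros s.
  assert (X : px c s = k * sin s + px c 0).
  { apply eq_of_derive_eq with (f := px c) (g := fun s => k * sin s + px c 0) (df := fun s => k * cos s) (a := 0).
    - intros x. rewrite <- (Hk x) at 1. apply px_derive.
    - intros x. auto_derive; auto. ring.
    - rewrite sin_0. ring. }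
  assert (Y : py c s = - k * cos s + (py c 0 + k)).
  { apply eq_of_derive_eq with (f := py c) (g := fun s => - k * cos s + (py c 0 + k)) (df := fun s => k * sin s) (a := 0).
    - intros x. rewrite <- (Hk x) at 1. apply py_derive.
    - intros x. auto_derive; auto. ring.
    - rewrite cos_0. ring. }
  rewrite X, Y. generalize (sin2_cos2 s). unfold Rsqr. intros E.
  transitivity (k ^ 2 * (sin s * sin s + cos s * cos s)); [ring | rewrite E; ring].
Qed.

End Rigidity.

(** * Tangent angle parametrization of the table *)

Lemma unit_vector_angle a b : a ^ 2 + b ^ 2 = 1 -> exists t, a = cos t /\ b = sin t.
Proof.
  intros E.
  assert (Ha : -1 <= a <= 1). { pose proof (pow2_ge_0 b). split; nra. }
  assert (S : sin (acos a) = Rabs b).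
  { rewrite sin_acos by auto. rewrite <- sqrt_Rsqr_abs. f_equal. unfold Rsqr. lra. }
  destruct (Rle_dec 0 b) as [H|H].
  - exists (acos a). rewrite cos_acos, S, Rabs_pos_eq; auto.
  - exists (- acos a). rewrite cos_neg, sin_neg, cos_acos, S, Rabs_left; auto; lra.
Qed.

Lemma full_turns_of_cos_sin x d : 0 < d -> cos (x + d) = cos x -> sin (x + d) = sin x ->
  exists k : nat, (1 <= k)%nat /\ d = INR k * (2 * PI).
Proof.
  intros Hd Ec Es. pose proof PI2_3_2 as HPI.
  assert (Cd : cos d = 1).
  { replace d with ((x + d) - x) by ring. rewrite cos_minus, Ec, Es.
    generalize (sin2_cos2 x). unfold Rsqr. lra. }
  destruct (reduce_mod (2 * PI) ltac:(lra) d) as [n Hn].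
  set (r := d + IZR n * (2 * PI)) in *.
  assert (Cr : cos r = 1).
  { unfold r. rewrite <- Cd. apply (periodic_Z cos (2 * PI)). intros; apply cos_period_2PI. }
  assert (r = 0).
  { assert (S : sin (r / 2) = 0).
    { replace r with (2 * (r / 2)) in Cr by field. rewrite cos_2a_sin in Cr.
      assert (Z : sin (r / 2) * sin (r / 2) = 0) by lra. now apply Rsqr_0_uniq. }
    apply sin_eq_0_lt_PI in S; lra. }
  assert (Ed : d = IZR (- n) * (2 * PI)) by (rewrite opp_IZR; unfold r in *; lra).
  assert (Hn0 : (0 < - n)%Z).
  { apply lt_IZR. apply Rmult_lt_reg_r with (2 * PI); lra. }
  exists (Z.to_nat (- n)). split; [lia|].
  rewrite INR_IZR_INZ, Z2Nat.id by lia. exact Ed.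
Qed.

Lemma smooth_second_derivative_continuity (f df ddf : R -> R) :
  smooth f -> (forall t, derivable_pt_lim f t (df t)) -> (forall t, derivable_pt_lim df t (ddf t)) ->
  continuity ddf.
Proof.
  intros [D [D0 D1]] Hf Hdf.
  assert (E1 : forall t, D 1%nat t = df t).
  { intros t. apply (uniqueness_limite f t); auto.
    apply is_derive_Reals. apply is_derive_ext with (D 0%nat); auto. apply is_derive_Reals, D1. }
  assert (E2 : forall t, D 2%nat t = ddf t).
  { intros t. apply (uniqueness_limite df t); auto.
    apply is_derive_Reals. apply is_derive_ext with (D 1%nat); auto. apply is_derive_Reals, D1. }
  intros t. apply continuity_pt_ext with (D 2%nat); auto.
  eapply is_derive_continuity. apply is_derive_Reals, D1.
Qed.

Lemma inverse_derive (f df g : R -> R) :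
  (forall t : R, is_derive f t (df t)) -> continuity df -> (forall t, 0 < df t) ->
  (forall s, f (g s) = s) -> forall s : R, is_derive g s (/ df (g s)).
Proof.
  intros D C P I s.
  assert (Inc : forall x y, x < y -> f x < f y).
  { intros x y H. apply strictly_increasing_of_derive with df; auto. }
  assert (Dec : forall x y, f x < f y -> x < y).
  { intros x y H. apply Rnot_le_lt. intros [N|N]; [apply Inc in N; lra | subst; lra]. }
  set (t := g s).
  apply is_derive_Reals. intros eps He.
  assert (Ci : continuity_pt (fun t => / df t) t).
  { apply continuity_pt_inv; [apply C | specialize (P t); lra]. }
  destruct (Ci eps He) as [eta [Heta Hc]].
  set (e := eta / 2).
  assert (L1 : f (t - e) < s) by (rewrite <- (I s); apply Inc; unfold t, e; lra).
  assert (L2 : s < f (t + e)) by (rewrite <- (I s) at 1; apply Inc; unfold t, e; lra).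
  assert (Hd : 0 < Rmin (s - f (t - e)) (f (t + e) - s)) by (apply Rmin_glb_lt; lra).
  exists (mkposreal _ Hd). simpl. intros h Hh Hhd.
  apply Rmin_Rgt_l in Hhd. destruct Hhd as [Ha Hb].
  apply Rabs_lt_between in Ha. apply Rabs_lt_between in Hb.
  set (t' := g (s + h)).
  assert (B1 : t - e < t') by (apply Dec; unfold t' at 1; rewrite I; lra).
  assert (B2 : t' < t + e) by (apply Dec; unfold t' at 1; rewrite I; lra).
  destruct (MVT_gen f t t' df) as [xi [Hxi E]]; auto.
  { intros; eapply is_derive_continuity, D. }
  unfold t' at 1, t at 1 in E. rewrite !I in E. replace (s + h - s) with h in E by ring.
  fold t. fold t'. pose proof (P xi).
  assert (N : t' - t <> 0) by (intros Z; rewrite Z, Rmult_0_r in E; contradiction).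
  replace ((t' - t) / h) with (/ df xi) by (rewrite E; field; split; lra).
  destruct (Req_dec xi t) as [->|Nx]; [rewrite Rminus_diag, Rabs_R0; auto|].
  apply Hc. split; [split; [exact Logic.I | auto]|]. simpl; unfold Rdist.
  assert (t - e <= xi <= t + e).
  { unfold Rmin, Rmax in Hxi. destruct (Rle_dec t t'); lra. }
  apply Rabs_lt_between. unfold e in *. lra.
Qed.

(** [psi] sends the parameter to the tangent angle and [time] goes back. [time_psi] transports the
    conclusion to every [t]; the frame equations transport the billiard map. *)
Record tangent_parametrization (X Y dX dY : R -> R) (c : strand) (psi time : R -> R) : Prop := {
  time_psi : forall t, time (psi t) = t;
  time_continuity : continuity time;
  px_time : forall s, px c s = X (time s);
  py_time : forall s, py c s = Y (time s);
  dX_time : forall s, dX (time s) = speed dX dY (time s) * cos s;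
  dY_time : forall s, dY (time s) = speed dX dY (time s) * sin s;
  speed_pos : forall t, 0 < speed dX dY t;
  curve_closed : closed c
}.

Lemma exists_tangent_parametrization X Y dX dY ddX ddY L :
  gutkin_table X Y dX dY ddX ddY L -> exists c psi time, tangent_parametrization X Y dX dY c psi time.
Proof.
  intros (SX & SY & DX & DY & DdX & DdY & HL & Per & Simple & Reg & Curv & _).
  pose proof PI2_3_2 as HPI.
  assert (CddX : continuity ddX) by exact (smooth_second_derivative_continuity X dX ddX SX DX DdX).
  assert (CddY : continuity ddY) by exact (smooth_second_derivative_continuity Y dY ddY SY DY DdY).
  assert (CdX : continuity dX) by (intros t; eapply is_derive_continuity, is_derive_Reals, DdX).
  assert (CdY : continuity dY) by (intros t; eapply is_derive_continuity, is_derive_Reals, DdY).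
  assert (Shift : forall f df, (forall t, derivable_pt_lim f t (df t)) -> (forall t, f (t + L) = f t) ->
     forall t, df (t + L) = df t).
  { intros f df Df Pf t. apply (uniqueness_limite f t); [|apply Df].
    apply is_derive_Reals. apply is_derive_ext with (fun t => f (t + L)); [intros; apply Pf|].
    apply is_derive_val with (1 * df (t + L)); [|ring].
    apply (is_derive_compose f (fun t => t + L)); [apply is_derive_Reals, Df | auto_derive; auto; ring]. }
  assert (PdX := Shift X dX DX (fun t => proj1 (Per t))).
  assert (PdY := Shift Y dY DY (fun t => proj2 (Per t))).
  assert (PddX := Shift dX ddX DdX PdX). assert (PddY := Shift dY ddY DdY PdY).
  set (v := speed dX dY).
  assert (Pv : forall t, 0 < v t) by (intros t; apply sqrt_lt_R0, Reg).
  assert (v2 : forall t, v t ^ 2 = dX t ^ 2 + dY t ^ 2) by (intros t; apply pow2_sqrt, Rlt_le, Reg).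
  assert (Cv : continuity v).
  { intros t. unfold v, speed.
    apply (continuity_pt_comp (fun t => dX t ^ 2 + dY t ^ 2) sqrt).
    - apply continuity_pt_plus.
      + apply (continuity_pt_comp dX (fun t => t ^ 2)); [apply CdX | apply derivable_continuous_pt; reg].
      + apply (continuity_pt_comp dY (fun t => t ^ 2)); [apply CdY | apply derivable_continuous_pt; reg].
    - apply continuity_pt_sqrt, Rlt_le, Reg. }
  (* Angular speed of the tangent, positive by the curvature hypothesis. *)
  set (om := fun t => (dX t * ddY t - dY t * ddX t) / (v t * v t)).
  assert (Pom : forall t, 0 < om t).
  { intros t. apply Rdiv_lt_0_compat; [apply Curv | apply Rmult_lt_0_compat; apply Pv]. }
  assert (Com : continuity om).
  { intros t. unfold om. apply continuity_pt_div.
    - apply continuity_pt_minus; apply continuity_pt_mult; auto.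
    - apply continuity_pt_mult; auto.
    - specialize (Pv t). nra. }
  assert (Dv : forall t : R, is_derive v t ((dX t * ddX t + dY t * ddY t) / v t)).
  { intros t. pose proof (proj2 (is_derive_Reals _ _ _) (DdX t)) as B1.
    pose proof (proj2 (is_derive_Reals _ _ _) (DdY t)) as B2. specialize (Reg t). specialize (Pv t).
    unfold v, speed in *. auto_derive.
    - repeat split; try (eexists; eassumption). now rewrite !Rmult_1_r in *; simpl in Reg; rewrite !Rmult_1_r in Reg.
    - rewrite (is_derive_unique (fun x : R => dX x) _ _ B1), (is_derive_unique (fun x : R => dY x) _ _ B2).
      simpl in *. rewrite !Rmult_1_r in *. field. lra. }
  set (a := fun t => dX t / v t). set (b := fun t => dY t / v t).
  assert (Da : forall t : R, is_derive a t (- b t * om t)).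
  { intros t. specialize (v2 t). specialize (Pv t). unfold a, b, om.
    apply is_derive_val with ((ddX t * v t - dX t * ((dX t * ddX t + dY t * ddY t) / v t)) / v t ^ 2).
    - apply is_derive_div; [apply is_derive_Reals, DdX | apply Dv | lra].
    - apply Rmult_eq_reg_r with (v t * v t * v t); [|apply Rgt_not_eq; repeat apply Rmult_lt_0_compat; auto].
      transitivity (ddX t * v t ^ 2 - dX t * (dX t * ddX t + dY t * ddY t)); [field; lra|].
      rewrite v2. field. lra. }
  assert (Db : forall t : R, is_derive b t (a t * om t)).
  { intros t. specialize (v2 t). specialize (Pv t). unfold a, b, om.
    apply is_derive_val with ((ddY t * v t - dY t * ((dX t * ddX t + dY t * ddY t) / v t)) / v t ^ 2).
    - apply is_derive_div; [apply is_derive_Reals, DdY | apply Dv | lra].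
    - apply Rmult_eq_reg_r with (v t * v t * v t); [|apply Rgt_not_eq; repeat apply Rmult_lt_0_compat; auto].
      transitivity (ddY t * v t ^ 2 - dY t * (dX t * ddX t + dY t * ddY t)); [field; lra|].
      rewrite v2. field. lra. }
  assert (ab : a 0 ^ 2 + b 0 ^ 2 = 1).
  { unfold a, b. transitivity ((dX 0 ^ 2 + dY 0 ^ 2) / v 0 ^ 2); [field; specialize (Pv 0); lra|].
    rewrite <- v2. field. specialize (Pv 0); lra. }
  destruct (unit_vector_angle _ _ ab) as [psi0 [Ea Eb]].
  set (psi := fun t => psi0 + RInt om 0 t).
  assert (Dpsi : forall t : R, is_derive psi t (om t)).
  { intros t. unfold psi. apply is_derive_val with (0 + om t); [|ring].
    apply (is_derive_plus (fun _ => psi0) (fun t => RInt om 0 t));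
      [apply (is_derive_const (V := R_NormedModule)) | now apply is_derive_RInt_continuity]. }
  assert (psi_0 : psi 0 = psi0) by (unfold psi; rewrite RInt_point; apply Rplus_0_r).
  assert (Cpsi : continuity psi) by (intros t; eapply is_derive_continuity, Dpsi).
  clearbody psi.
  (* The unit tangent and [(cos psi, sin psi)] rotate at the same speed [om], so their inner and
     cross products keep their values at [t = 0]. *)
  assert (Fr : forall t, a t = cos (psi t) /\ b t = sin (psi t)).
  { assert (E1 : forall t, a t * cos (psi t) + b t * sin (psi t) = 1).
    { apply eq_of_derive_eq with (df := fun _ => 0) (a := 0).
      - intros t. pose proof (Da t) as B1. pose proof (Db t) as B2. pose proof (Dpsi t) as B3.
        clearbody a b. auto_derive; [repeat split; try (eexists; eassumption)|].
        rewrite (is_derive_unique (fun x : R => a x) _ _ B1), (is_derive_unique (fun x : R => b x) _ _ B2),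
          (is_derive_unique (fun x : R => psi x) _ _ B3). ring.
      - intros t. apply (is_derive_const (V := R_NormedModule)).
      - rewrite psi_0, Ea, Eb. generalize (sin2_cos2 psi0). unfold Rsqr. lra. }
    assert (E2 : forall t, b t * cos (psi t) - a t * sin (psi t) = 0).
    { apply eq_of_derive_eq with (df := fun _ => 0) (a := 0).
      - intros t. pose proof (Da t) as B1. pose proof (Db t) as B2. pose proof (Dpsi t) as B3.
        clearbody a b. auto_derive; [repeat split; try (eexists; eassumption)|].
        rewrite (is_derive_unique (fun x : R => a x) _ _ B1), (is_derive_unique (fun x : R => b x) _ _ B2),
          (is_derive_unique (fun x : R => psi x) _ _ B3). ring.
      - intros t. apply (is_derive_const (V := R_NormedModule)).
      - rewrite psi_0, Ea, Eb. ring. }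
    intros t. specialize (E1 t). specialize (E2 t).
    generalize (sin2_cos2 (psi t)). unfold Rsqr. intros SC. split.
    - transitivity (a t * (sin (psi t) * sin (psi t) + cos (psi t) * cos (psi t))); [rewrite SC; ring|].
      transitivity ((a t * cos (psi t) + b t * sin (psi t)) * cos (psi t)
        - (b t * cos (psi t) - a t * sin (psi t)) * sin (psi t)); [ring | rewrite E1, E2; ring].
    - transitivity (b t * (sin (psi t) * sin (psi t) + cos (psi t) * cos (psi t))); [rewrite SC; ring|].
      transitivity ((a t * cos (psi t) + b t * sin (psi t)) * sin (psi t)
        + (b t * cos (psi t) - a t * sin (psi t)) * cos (psi t)); [ring | rewrite E1, E2; ring]. }
  assert (FX : forall t, dX t = v t * cos (psi t)).
  { intros t. rewrite <- (proj1 (Fr t)). unfold a. field. specialize (Pv t). lra. }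
  assert (FY : forall t, dY t = v t * sin (psi t)).
  { intros t. rewrite <- (proj2 (Fr t)). unfold b. field. specialize (Pv t). lra. }
  assert (vper : forall t, v (t + L) = v t) by (intros t; unfold v, speed; now rewrite PdX, PdY).
  assert (omper : forall t, om (t + L) = om t) by (intros t; unfold om; now rewrite vper, PdX, PdY, PddX, PddY).
  set (d := psi L - psi 0).
  assert (Psid : forall t, psi (t + L) = psi t + d).
  { apply eq_of_derive_eq with (df := om) (a := 0).
    - intros t. apply is_derive_val with (1 * om (t + L)); [|rewrite omper; ring].
      apply (is_derive_compose psi (fun t => t + L)); [apply Dpsi | auto_derive; auto; ring].
    - intros t. apply is_derive_val with (om t + 0); [|ring].
      apply (is_derive_plus psi (fun _ => d)); [apply Dpsi | apply (is_derive_const (V := R_NormedModule))].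
    - unfold d. rewrite Rplus_0_l. ring. }
  assert (Inc : forall x y, x < y -> psi x < psi y).
  { intros x y H. apply strictly_increasing_of_derive with om; auto. }
  assert (Hd : 0 < d) by (unfold d; specialize (Inc 0 L HL); lra).
  destruct (full_turns_of_cos_sin (psi 0) d Hd) as [k [Hk Ek]].
  { rewrite <- Psid. destruct (Fr (0 + L)) as [<- _], (Fr 0) as [<- _]. unfold a. now rewrite vper, PdX. }
  { rewrite <- Psid. destruct (Fr (0 + L)) as [_ <-], (Fr 0) as [_ <-]. unfold b. now rewrite vper, PdY. }
  assert (Psin : forall (n : nat) t, psi (t + INR n * L) = psi t + INR n * d).
  { intros n. induction n as [|n IH]; intros t.
    - simpl. rewrite !Rmult_0_l, !Rplus_0_r. auto.
    - rewrite S_INR. replace (t + (INR n + 1) * L) with ((t + INR n * L) + L) by ring.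
      rewrite Psid, IH. ring. }
  (* Each period adds the positive amount [d] to [psi], which is therefore unbounded in both
     directions. *)
  assert (Onto : forall s, {t | psi t = s}).
  { intros s. apply constructive_indefinite_description.
    destruct (INR_unbounded (Rabs (s - psi 0) / d)) as [n Hn].
    apply Rmult_gt_compat_r with (r := d) in Hn; auto.
    unfold Rdiv in Hn. rewrite Rmult_assoc, Rinv_l, Rmult_1_r in Hn by lra.
    pose proof (Rle_abs (s - psi 0)). pose proof (Rabs_maj2 (s - psi 0)).
    assert (Hn0 : 0 < INR n). { pose proof (Rabs_pos (s - psi 0)). apply Rnot_le_lt; intros N; nra. }
    assert (P1 : psi (INR n * L) = psi 0 + INR n * d) by (rewrite <- Psin; f_equal; ring).
    assert (P2 : psi (- (INR n * L)) = psi 0 - INR n * d).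
    { pose proof (Psin n (- (INR n * L))) as E. replace (- (INR n * L) + INR n * L) with 0 in E by ring. lra. }
    destruct (IVT (fun t => psi t - s) (- (INR n * L)) (INR n * L)) as [t [_ Et]].
    - apply (continuity_minus psi (fun _ => s)); auto. apply continuity_const; now intros ? ?.
    - assert (0 < INR n * L) by (apply Rmult_lt_0_compat; auto). lra.
    - lra.
    - lra.
    - exists t. lra. }
  set (time := fun s => proj1_sig (Onto s)).
  assert (PT : forall s, psi (time s) = s) by (intros s; unfold time; apply proj2_sig).
  clearbody time.
  assert (Inj : forall x y, psi x = psi y -> x = y).
  { intros x y E. destruct (Rtotal_order x y) as [H|[H|H]]; auto; apply Inc in H; lra. }
  assert (TP : forall t, time (psi t) = t) by (intros t; apply Inj, PT).
  assert (Dtime : forall s : R, is_derive time s (/ om (time s))) by (now apply inverse_derive with psi).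
  assert (Ctime : continuity time) by (intros s; eapply is_derive_continuity, Dtime).
  assert (Tper : forall s, time (s + d) = time s + L) by (intros s; apply Inj; rewrite Psid, !PT; auto).
  assert (Tinc : forall x y, x < y -> time x < time y).
  { intros x y H. apply Rnot_le_lt. intros [N|N].
    - apply Inc in N. rewrite !PT in N. lra.
    - apply (f_equal psi) in N. rewrite !PT in N. lra. }
  assert (rp : forall s, 0 < v (time s) / om (time s)) by (intros s; apply Rdiv_lt_0_compat; auto).
  assert (rc : continuity (fun s => v (time s) / om (time s))).
  { intros s. apply (continuity_pt_comp time (fun t => v t / om t)); [apply Ctime|].
    apply continuity_pt_div; auto. specialize (Pom (time s)); lra. }
  assert (dx : forall s : R, is_derive (fun s => X (time s)) s (v (time s) / om (time s) * cos s)).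
  { intros s. apply is_derive_val with (/ om (time s) * dX (time s)).
    - apply (is_derive_compose X time); [apply is_derive_Reals, DX | apply Dtime].
    - rewrite FX, PT. unfold Rdiv. ring. }
  assert (dy : forall s : R, is_derive (fun s => Y (time s)) s (v (time s) / om (time s) * sin s)).
  { intros s. apply is_derive_val with (/ om (time s) * dY (time s)).
    - apply (is_derive_compose Y time); [apply is_derive_Reals, DY | apply Dtime].
    - rewrite FY, PT. unfold Rdiv. ring. }
  set (c := Build_strand _ _ _ rp rc dx dy).
  assert (Simple' : forall t1 t2, t1 < t2 < t1 + L -> ~ (X t1 = X t2 /\ Y t1 = Y t2)).
  { intros t1 t2 Ht [E1 E2].
    destruct (reduce_mod L HL t1) as [n Hn], (reduce_mod L HL t2) as [m Hm].
    assert (E : t1 + IZR n * L = t2 + IZR m * L).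
    { apply Simple; auto.
      - rewrite !(periodic_Z X L (fun t => proj1 (Per t))); auto.
      - rewrite !(periodic_Z Y L (fun t => proj2 (Per t))); auto. }
    assert (Q : t2 - t1 = IZR (n - m) * L) by (rewrite minus_IZR; lra).
    assert (Q1 : (0 < n - m)%Z) by (apply lt_IZR; apply Rmult_lt_reg_r with L; lra).
    assert (Q2 : (n - m < 1)%Z) by (apply lt_IZR; apply Rmult_lt_reg_r with L; lra).
    lia. }
  (* At this stage [c] has period [d = 2 PI k]; simplicity of the table identifies [k], and with it
     closedness. *)
  assert (k1 : k = 1%nat).
  { apply (turning_number_one c k Hk); rewrite <- Ek; unfold c; simpl.
    - intros s. rewrite Tper. apply Per.
    - intros s1 s2 Hs. apply Simple'. split; [apply Tinc; lra|].
      rewrite <- Tper. apply Tinc; lra. }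
  assert (d2 : d = 2 * PI) by (rewrite Ek, k1; simpl; ring).
  rewrite d2 in Tper.
  exists c, psi, time. constructor; auto.
  - intros s. fold v. rewrite FX at 1. now rewrite PT.
  - intros s. fold v. rewrite FY at 1. now rewrite PT.
  - intros s. unfold c; simpl. rewrite Tper. apply Per.
Qed.

(** The hypotheses quantify over billiard steps while the argument tests them on chords, so this
    direction of the dictionary is the one required. *)
Lemma chord_billiard_step X Y dX dY c psi time s a b r :
  tangent_parametrization X Y dX dY c psi time ->
  0 < a < PI -> 0 < b < PI -> chord c s a b r ->
  billiard_step X Y dX dY (time s) a (time (s + a + b)) b.
Proof.
  intros TPm Ha Hb [Hr [EX EY]].
  rewrite !(px_time _ _ _ _ _ _ _ TPm) in EX. rewrite !(py_time _ _ _ _ _ _ _ TPm) in EY.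
  pose proof (speed_pos _ _ _ _ _ _ _ TPm (time s)) as S1.
  pose proof (speed_pos _ _ _ _ _ _ _ TPm (time (s + a + b))) as S2.
  pose proof (dX_time _ _ _ _ _ _ _ TPm) as FX. pose proof (dY_time _ _ _ _ _ _ _ TPm) as FY.
  generalize (sin2_cos2 (s + a)). unfold Rsqr. intros SC.
  split; auto. split; auto. split; [|split].
  - destruct (Req_dec (X (time (s + a + b))) (X (time s))) as [E1|N]; auto.
    destruct (Req_dec (Y (time (s + a + b))) (Y (time s))) as [E2|N]; auto.
    exfalso. rewrite E1, Rminus_diag in EX. rewrite E2, Rminus_diag in EY.
    assert (cos (s + a) = 0) by nra. assert (sin (s + a) = 0) by nra. nra.
  - exists r. split; auto. rewrite EX, EY, (FX s), (FY s). set (v := speed dX dY (time s)) in *.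
    rewrite cos_plus, sin_plus. split; field; lra.
  - rewrite EX, EY.
    replace (sqrt ((r * cos (s + a)) ^ 2 + (r * sin (s + a)) ^ 2)) with r.
    + rewrite (FX (s + a + b)), (FY (s + a + b)). set (v := speed dX dY (time (s + a + b))) in *.
      replace b with ((s + a + b) - (s + a)) at 1 by ring. rewrite cos_minus. field. lra.
    + replace ((r * cos (s + a)) ^ 2 + (r * sin (s + a)) ^ 2) with (r ^ 2).
      * symmetry. apply sqrt_pow2. lra.
      * transitivity (r ^ 2 * (sin (s + a) * sin (s + a) + cos (s + a) * cos (s + a))); [rewrite SC|]; ring.
Qed.

Theorem theorem1p3 (X Y dX dY ddX ddY : R -> R) (L d1 d2 : R) :
  gutkin_table X Y dX dY ddX ddY L ->
  0 <= d1 -> d1 < d2 -> d2 <= PI / 2 ->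
  (d1 = 0 \/ const_angle_invariant X Y dX dY d1) ->
  const_angle_invariant X Y dX dY d2 ->
  (forall d, d1 < d < d2 -> ~ const_angle_invariant X Y dX dY d) ->
  strip_foliated X Y dX dY L d1 d2 ->
  exists cx cy r : R, 0 < r /\
    forall t, (X t - cx) ^ 2 + (Y t - cy) ^ 2 = r ^ 2.
Proof.
  intros Table H1 H12 H2 I1 I2 _ [F [HF [_ Cover]]]. pose proof PI2_3_2 as HPI.
  destruct (exists_tangent_parametrization _ _ _ _ _ _ _ Table) as [c [psi [time TPm]]].
  pose proof (curve_closed _ _ _ _ _ _ _ TPm) as Hc.
  assert (Const : forall d, 0 < d < PI -> const_angle_invariant X Y dX dY d ->
     forall s b r, 0 < b < PI -> chord c s d b r -> b = d).
  { intros d Hd Inv s b r Hb Hch. apply (Inv (time s) (time (s + d + b))).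
    now apply (chord_billiard_step X Y dX dY c psi time s d b r). }
  assert (Leaves : forall s a, d1 <= a <= d2 -> exists g, invariant_leaf c g /\ g s = a).
  { intros s a Ha. destruct (Cover (time s) a Ha) as [g [Fg Eg]].
    destruct (HF g Fg) as [Cg [_ [Rg Ig]]].
    exists (fun s => g (time s)). split; auto. split; [|split].
    - intros x. apply (continuity_pt_comp time g); [apply (time_continuity _ _ _ _ _ _ _ TPm) | apply Cg].
    - intros x. specialize (Rg (time x)). lra.
    - intros x b r G Hb Hch. symmetry. apply (Ig (time x)).
      apply (chord_billiard_step X Y dX dY c psi time x _ b r); auto.
      specialize (Rg (time x)). lra. }
  assert (Iso : total_width c ^ 2 <= 2 * PI * RInt (fun s => supp c s * rad c s) 0 (2 * PI)).
  { apply (reversed_isoperimetric c d1 d2); auto.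
    (* The split is on [d1 = 0] rather than on [I1], as [Const] asks for a positive angle. *)
    - destruct (Req_dec d1 0) as [E|N]; auto. right. apply Const; [lra|].
      destruct I1; [contradiction | auto].
    - apply Const; auto; lra. }
  destruct (rad_constant c Hc Iso) as [k Hk].
  destruct (circle_of_rad_constant c k Hk) as [x0 [y0 Hcirc]].
  exists x0, y0, k. split; [rewrite <- (Hk 0); apply rad_pos|].
  intros t. specialize (Hcirc (psi t)).
  now rewrite (px_time _ _ _ _ _ _ _ TPm), (py_time _ _ _ _ _ _ _ TPm), (time_psi _ _ _ _ _ _ _ TPm) in Hcirc.
Qed.
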